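(* Let $i:Y^4\to(X^n,g)$ be an immersion with $n>4$. Then the critical extrinsic $Q$-curvature satisfies $$Q=2\,\overline{\mathrm{Pf}}+\mathcal W_Q-\overline\nabla^\alpha\bigl(\overline\nabla_\alpha\overline{\mathsf J}-2\overline\nabla_\alpha\mathsf G-2\mathcal C_\alpha+2\mathsf D^{\beta\alpha'}\mathring L_{\alpha\beta\alpha'}\bigr)$$ with $$\mathcal W_Q=-\frac14|\overline W|^2+\mathcal I+2|\mathsf F|^2-2\mathsf G^2 .$$
   Context: **Curvature.** $\nabla$ is the Levi-Civita connection of $g$; $R_{abcd}$ is determined by $\nabla_a\nabla_b\tau_c-\nabla_b\nabla_a\tau_c=R_{abc}{}^d\tau_d$; $R_{ab}=R_{acb}{}^c$, $R=R_a{}^a$, $\mathsf J=\frac{R}{2(n-1)}$, $\mathsf P_{ab}=\frac1{n-2}(R_{ab}-\mathsf Jg_{ab})$, $W_{abcd}=R_{abcd}-\mathsf P_{ac}g_{bd}-\mathsf P_{bd}g_{ac}+\mathsf P_{ad}g_{bc}+\mathsf P_{bc}g_{ad}$, $C_{abc}=\nabla_a\mathsf P_{bc}-\nabla_b\mathsf P_{ac}$, $B_{ab}=\nabla^cC_{cab}+W_{acbd}\mathsf P^{cd}$. Round parentheses on indices denote symmetrization: $T_{(ab)}=\frac12(T_{ab}+T_{ba})$. **Submanifold** (here $k=4$). $i^*TX=TY\oplus NY$ ($g$-orthogonal); abstract indices $\alpha,\beta,\gamma,\dots$ denote projection to $TY$, primed indices projection to $NY$, Latin indices label $i^*TX$;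 indices are raised and lowered with $g$. $\overline\nabla$ is the connection on $TY$ and $NY$ obtained by projecting $\nabla$; $\overline\Delta=\overline\nabla^\alpha\overline\nabla_\alpha$. $\overline W$, $\overline{\mathsf P}$, $\overline{\mathsf J}=\overline{\mathsf P}_\alpha{}^\alpha$ are the Weyl tensor, Schouten tensor and its trace for $i^*g$. Norms are full contractions. $L(U,V)=(\nabla_UV)^\perp$ is the second fundamental form $L_{\alpha\beta\alpha'}$, $H_{\alpha'}=\frac1kL_\alpha{}^\alpha{}_{\alpha'}$, $\mathring L_{\alpha\beta\alpha'}=L_{\alpha\beta\alpha'}-H_{\alpha'}g_{\alpha\beta}$, $\mathring L^2_{\alpha\beta}=\mathring L^\gamma{}_{\alpha\alpha'}\mathring L_{\gamma\beta}{}^{\alpha'}$. Define $\mathsf F_{\alpha\beta}=\frac1{k-2}\bigl(\mathring L^2_{\alpha\beta}-W_{\alpha\gamma\beta}{}^\gamma-\mathsf Gg_{\alpha\beta}\bigr)$, $\mathsf G=\mathsf F_\alpha{}^\alpha=\frac1{2(k-1)}\bigl(|\mathring L|^2-W_{\alpha\beta}{}^{\alpha\beta}\bigr)$; $\mathsf D_{\alpha\alpha'}=\mathsf P_{\alpha\alpha'}-\overline\nabla_\alpha H_{\alpha'}$; $\mathcal P_{\alpha\beta}=\mathsf P_{\alpha\beta}+H^{\alpha'}\mathring L_{\alpha\beta\alpha'}+\frac12H^{\alpha'}H_{\alpha'}g_{\alpha\beta}$; $\mathcal C_{abc}=C_{abc}-H^{\alpha'}W_{abc\alpha'}$, $\mathcal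 C_a=\mathcal C_{\beta a}{}^\beta$; $\mathcal B_{\alpha\beta}=B_{\alpha\beta}+2(n-4)H^{\alpha'}C_{\alpha'(\alpha\beta)}+(n-4)H^{\alpha'}H^{\beta'}W_{\alpha\alpha'\beta\beta'}$. $\mathcal I$ denotes (with $k=4$) the scalar $$\mathcal I=(k-1)\bigl(-\overline\Delta\mathsf G+2\mathsf G\mathcal P_\alpha{}^\alpha\bigr)+(k-6)\Bigl[\bigl(\mathring L^2_{\alpha\beta}-W_{\alpha\gamma\beta}{}^\gamma\bigr)\mathcal P^{\alpha\beta}+\overline\nabla^\alpha\bigl(\mathcal C_\alpha-\mathsf D^{\beta\alpha'}\mathring L_{\alpha\beta\alpha'}\bigr)+\tfrac{k-3}{n-4}\mathcal B_\alpha{}^\alpha-(k-3)|\mathsf D|^2\Bigr].$$ $\overline{\mathrm{Pf}}$ is the Pfaffian of the curvature of $i^*g$, normalized so that $\int_Y\overline{\mathrm{Pf}}\,dA=(2\pi)^2\chi(Y)$ for closed $Y$, i.e. $\overline{\mathrm{Pf}}=\frac18|\overline W|^2+\overline{\mathsf J}^2-|\overline{\mathsf P}|^2$. The critical extrinsic $Q$-curvature of Case–Graham–Kuo for $k=4$ is given explicitly by $$Q=-\overline\Delta\,\overline{\mathsf J}-2|\overline{\mathsf P}|^2+2\overline{\mathsf J}^2-\overline\Delta\mathsf G-2|\mathsf F|^2+2\mathsf G^2-4\mathsf F_{\alpha\beta}\overline{\mathsf P}^{\alpha\beta}+4\mathsf G\,\overline{\mathsf J}-\frac2{n-4}\mathcal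 B_\alpha{}^\alpha+2|\mathsf D|^2 .$$ *)

(* Defs.v *)
From HB Require Import structures.
From mathcomp Require Import all_boot all_order all_algebra.
From mathcomp Require Import all_classical all_reals all_analysis.

Set Implicit Arguments.
Unset Strict Implicit.
Unset Printing Implicit Defensive.

Import Order.TTheory GRing.Theory Num.Theory.
Import numFieldNormedType.Exports.

Local Open Scope classical_set_scope.
Local Open Scope ring_scope.

Section Smooth.
Context {R : realType} {m : nat} {V : normedModType R}.

Definition pd (i : 'I_m) (f : 'rV[R]_m -> V) (x : 'rV[R]_m) : V :=
  'D_(delta_mx 0 i) f x.

(* Meant for U open. *)
Fixpoint Ck_on (k : nat) (U : set 'rV[R]_m) (f : 'rV[R]_m -> V) : Prop :=
  if k is k'.+1 then
    (forall x, U x -> differentiable f x) /\ (forall i, Ck_on k' U (pd i f))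
  else forall x, U x -> {for x, continuous f}.

Definition smooth_on (U : set 'rV[R]_m) (f : 'rV[R]_m -> V) : Prop :=
  forall k, Ck_on k U f.

End Smooth.

(* [chart_inv] is total; only its values on the image of the chart matter. *)
Record smooth_manifold (R : realType) (m : nat) := SmoothManifold {
  mspace :> topologicalType ;
  mspace_hausdorff : hausdorff_space mspace ;
  mspace_second_countable : @second_countable mspace ;
  atlas : Type ;
  chart_dom : atlas -> set mspace ;
  chart : atlas -> mspace -> 'rV[R]_m ;
  chart_inv : atlas -> 'rV[R]_m -> mspace ;
  chart_cover : forall p, exists a, chart_dom a p ;
  chart_dom_open : forall a, open (chart_dom a) ;
  chart_img_open : forall a, open (chart a @` chart_dom a) ;
  chartK : forall a p, chart_dom a p -> chart_inv a (chart a p) = p ;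
  chart_continuous : forall a p, chart_dom a p -> {for p, continuous (chart a)} ;
  chart_inv_continuous : forall a x, (chart a @` chart_dom a) x ->
    {for x, continuous (chart_inv a)} ;
  transition_smooth : forall a b,
    smooth_on (chart a @` (chart_dom a `&` chart_dom b)) (chart b \o chart_inv a)
}.

Arguments chart_dom {R m s}.
Arguments chart {R m s}.
Arguments chart_inv {R m s}.

(* The matrix ['J f x] of the library acts on row vectors: its (i, j) entry is
   the derivative of the j-th component of f in the i-th direction. *)
Record riemannian_metric (R : realType) (m : nat) (X : smooth_manifold R m) :=
  RiemannianMetric {
  metric_in : atlas X -> 'rV[R]_m -> 'M[R]_m ;
  metric_smooth : forall a i j,
    smooth_on (chart a @` chart_dom a) (fun x => metric_in a x i j) ;
  metric_sym : forall a x, (chart a @` chart_dom a) x ->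
    (metric_in a x)^T = metric_in a x ;
  metric_pos : forall a x, (chart a @` chart_dom a) x ->
    forall v : 'rV[R]_m, v != 0 -> 0 < (v *m metric_in a x *m v^T) 0 0 ;
  metric_compat : forall a b x, (chart a @` (chart_dom a `&` chart_dom b)) x ->
    let t := chart b \o chart_inv a in
    metric_in a x = 'J t x *m metric_in b (t x) *m ('J t x)^T
}.

Section Maps.
Context {R : realType} {k n : nat}.
Context {Y : smooth_manifold R k} {X : smooth_manifold R n}.
Implicit Types (f : Y -> X) (a : atlas Y) (b : atlas X).

Definition local_rep f a b : 'rV[R]_k -> 'rV[R]_n :=
  chart b \o f \o chart_inv a.

Definition local_dom f a b : set 'rV[R]_k :=
  chart a @` (chart_dom a `&` f @^-1` chart_dom b).

Definition smooth_map f : Prop :=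
  continuous f /\ forall a b, smooth_on (local_dom f a b) (local_rep f a b).

Definition immersion f : Prop :=
  smooth_map f /\
  forall a b x, local_dom f a b x -> row_free ('J (local_rep f a b) x).

End Maps.

(* Covariant tensors are given by their component functions; in [cov1], [cov2],
   [cov3] the first index is the index of the derivative. *)
Section Intrinsic.
Context {R : realType} {m : nat}.
Variable g : 'rV[R]_m -> 'M[R]_m.
Implicit Types (a b c d e f : 'I_m) (x : 'rV[R]_m).

Definition ginv a b x : R := invmx (g x) a b.

Definition christoffel c a b x : R :=
  2^-1 * \sum_d ginv c d x *
    (pd a (fun y => g y d b) x + pd b (fun y => g y d a) x
     - pd d (fun y => g y a b) x).

Definition cov1 (T : 'I_m -> 'rV[R]_m -> R) a b x : R :=
  pd a (T b) x - \sum_d christoffel d a b x * T d x.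

Definition cov2 (T : 'I_m -> 'I_m -> 'rV[R]_m -> R) a b c x : R :=
  pd a (T b c) x - \sum_d christoffel d a b x * T d c x
                 - \sum_d christoffel d a c x * T b d x.

Definition cov3 (T : 'I_m -> 'I_m -> 'I_m -> 'rV[R]_m -> R) a b c d x : R :=
  pd a (T b c d) x - \sum_e christoffel e a b x * T e c d x
                   - \sum_e christoffel e a c x * T b e d x
                   - \sum_e christoffel e a d x * T b c e x.

(* [coframe d] is the coordinate 1-form dx^d.  Taking tau = dx^d in
   (nabla_a nabla_b - nabla_b nabla_a) tau_c = R_{abc}^d tau_d
   gives the components R_{abc}^d. *)
Definition coframe d c x : R := (c == d)%:R.

Definition riem_up a b c d x : R :=
  cov2 (cov1 (coframe d)) a b c x - cov2 (cov1 (coframe d)) b a c x.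

Definition riem a b c d x : R := \sum_e riem_up a b c e x * g x e d.

Definition ricci a b x : R := \sum_c riem_up a c b c x.

Definition tr2 (T : 'I_m -> 'I_m -> 'rV[R]_m -> R) x : R :=
  \sum_a \sum_b ginv a b x * T a b x.

Definition inner2 (S T : 'I_m -> 'I_m -> 'rV[R]_m -> R) x : R :=
  \sum_a \sum_b \sum_c \sum_d
    ginv a c x * ginv b d x * S a b x * T c d x.

Definition normsq4 (T : 'I_m -> 'I_m -> 'I_m -> 'I_m -> 'rV[R]_m -> R) x : R :=
  \sum_a \sum_b \sum_c \sum_d \sum_a' \sum_b' \sum_c' \sum_d'
    ginv a a' x * ginv b b' x * ginv c c' x * ginv d d' x
    * T a b c d x * T a' b' c' d' x.

Definition scalar_curvature x : R := tr2 ricci x.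

Definition schoutenJ x : R := scalar_curvature x / (2 * (m%:R - 1)).

Definition schouten a b x : R :=
  (m%:R - 2)^-1 * (ricci a b x - schoutenJ x * g x a b).

Definition weyl a b c d x : R :=
  riem a b c d x - schouten a c x * g x b d - schouten b d x * g x a c
  + schouten a d x * g x b c + schouten b c x * g x a d.

Definition cotton a b c x : R := cov2 schouten a b c x - cov2 schouten b a c x.

Definition bach a b x : R :=
  (\sum_c \sum_d ginv c d x * cov3 cotton d c a b x)
  + \sum_c \sum_d \sum_e \sum_f
      weyl a c b d x * ginv c e x * ginv d f x * schouten e f x.

Definition divergence (T : 'I_m -> 'rV[R]_m -> R) x : R := tr2 (cov1 T) x.

Definition laplacian (f : 'rV[R]_m -> R) x : R := divergence (fun a => pd a f) x.

End Intrinsic.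

(* [g] is the metric of X in a chart and [u] the immersion read in charts of Y
   and X.  Tangential (Greek) indices alpha .. delta are indices of the chart
   of Y; normal (primed) and Latin indices a .. f are indices of the chart of X,
   a normal index marking a component function annihilated by TY. *)
Section Extrinsic.
Context {R : realType} {k n : nat}.
Variables (g : 'rV[R]_n -> 'M[R]_n) (u : 'rV[R]_k -> 'rV[R]_n).
Implicit Types (alpha beta gamma delta : 'I_k) (a b c d : 'I_n) (x : 'rV[R]_k).

Definition tangent alpha a x : R := 'J u x alpha a.

Definition pullback_metric x : 'M[R]_k := 'J u x *m g (u x) *m ('J u x)^T.

Local Notation h := pullback_metric.
Local Notation e := tangent.
Local Notation hinv := (ginv h).
Local Notation gupper a b x := (ginv g a b (u x)).

(* Entry (b, a) is N^b_a, where N is the orthogonal projection onto NY. *)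
Definition normal_proj x : 'M[R]_n :=
  1%:M - ('J u x)^T *m invmx (h x) *m 'J u x *m g (u x).

Definition tan2 (T : 'I_n -> 'I_n -> 'rV[R]_n -> R) alpha beta x : R :=
  \sum_a \sum_b T a b (u x) * e alpha a x * e beta b x.

Definition tan3 (T : 'I_n -> 'I_n -> 'I_n -> 'rV[R]_n -> R)
    alpha beta gamma x : R :=
  \sum_a \sum_b \sum_c
    T a b c (u x) * e alpha a x * e beta b x * e gamma c x.

Definition tan4 (T : 'I_n -> 'I_n -> 'I_n -> 'I_n -> 'rV[R]_n -> R)
    alpha beta gamma delta x : R :=
  \sum_a \sum_b \sum_c \sum_d
    T a b c d (u x) * e alpha a x * e beta b x * e gamma c x * e delta d x.

(* L(d_alpha, d_beta) = (nabla_{d_alpha} d_beta)^perp, as a vector along Y. *)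
Definition sff_up alpha beta a x : R :=
  \sum_b normal_proj x a b *
    (pd alpha (e beta b) x
     + \sum_c \sum_d christoffel g b c d (u x) * e alpha c x * e beta d x).

Definition sff alpha beta a x : R := \sum_b g (u x) a b * sff_up alpha beta b x.

Definition mean_curv a x : R :=
  k%:R^-1 * \sum_alpha \sum_beta hinv alpha beta x * sff alpha beta a x.

Definition mean_curv_up a x : R := \sum_b gupper a b x * mean_curv b x.

Local Notation H := mean_curv_up.

Definition sff0 alpha beta a x : R :=
  sff alpha beta a x - mean_curv a x * h x alpha beta.

(* Connection on the conormal bundle: pull-back of the ambient connection
   followed by projection. *)
Definition cov_normal (T : 'I_n -> 'rV[R]_k -> R) alpha a x : R :=
  \sum_b normal_proj x b a *
    (pd alpha (T b) x
     - \sum_c \sum_d christoffel g d c b (u x) * e alpha c x * T d x).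

Definition sff0_sq alpha beta x : R :=
  \sum_gamma \sum_delta \sum_a \sum_b
    hinv gamma delta x * gupper a b x
    * sff0 gamma alpha a x * sff0 delta beta b x.

Definition sff0_normsq x : R :=
  \sum_alpha \sum_beta \sum_gamma \sum_delta \sum_a \sum_b
    hinv alpha gamma x * hinv beta delta x * gupper a b x
    * sff0 alpha beta a x * sff0 gamma delta b x.

Definition weyl_tr alpha beta x : R :=
  \sum_gamma \sum_delta
    hinv gamma delta x * tan4 (weyl g) alpha gamma beta delta x.

Definition weyl_trtr x : R :=
  \sum_alpha \sum_beta \sum_gamma \sum_delta
    hinv alpha gamma x * hinv beta delta x
    * tan4 (weyl g) alpha beta gamma delta x.

Definition sfG x : R :=
  (2 * (k%:R - 1))^-1 * (sff0_normsq x - weyl_trtr x).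

Definition sfF alpha beta x : R :=
  (k%:R - 2)^-1 *
    (sff0_sq alpha beta x - weyl_tr alpha beta x - sfG x * h x alpha beta).

Definition sfD alpha a x : R :=
  (\sum_b \sum_c schouten g b c (u x) * e alpha b x * normal_proj x c a)
  - cov_normal mean_curv alpha a x.

Definition calP alpha beta x : R :=
  tan2 (schouten g) alpha beta x
  + (\sum_a H a x * sff0 alpha beta a x)
  + 2^-1 * (\sum_a H a x * mean_curv a x) * h x alpha beta.

Definition calC3 a b c x : R :=
  cotton g a b c (u x) - \sum_d H d x * weyl g a b c d (u x).

Definition calC alpha x : R :=
  \sum_beta \sum_gamma hinv beta gamma x *
    \sum_a \sum_b \sum_c
      calC3 a b c x * e beta a x * e alpha b x * e gamma c x.

(* The primed indices of C and W are contracted with the normal vector H, so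
   they need no further projection. *)
Definition calB alpha beta x : R :=
  tan2 (bach g) alpha beta x
  + 2 * (n%:R - 4) *
    (\sum_a \sum_b \sum_c H a x *
       (2^-1 * (cotton g a b c (u x) + cotton g a c b (u x)))
       * e alpha b x * e beta c x)
  + (n%:R - 4) *
    (\sum_a \sum_b \sum_c \sum_d H b x * H d x * weyl g a b c d (u x)
       * e alpha a x * e beta c x).

Definition sfD_sff0 alpha x : R :=
  \sum_beta \sum_gamma \sum_a \sum_b
    hinv beta gamma x * gupper a b x * sfD gamma a x * sff0 alpha beta b x.

Definition sfD_normsq x : R :=
  \sum_alpha \sum_beta \sum_a \sum_b
    hinv alpha beta x * gupper a b x * sfD alpha a x * sfD beta b x.

Definition calI x : R :=
  (k%:R - 1) * (- laplacian h sfG x + 2 * sfG x * tr2 h calP x)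
  + (k%:R - 6) *
    (inner2 h (fun alpha beta y => sff0_sq alpha beta y - weyl_tr alpha beta y)
       calP x
     + divergence h (fun alpha y => calC alpha y - sfD_sff0 alpha y) x
     + (k%:R - 3) / (n%:R - 4) * tr2 h calB x
     - (k%:R - 3) * sfD_normsq x).

Definition schouten_bar := schouten h.

Definition J_bar := tr2 h schouten_bar.

End Extrinsic.

Section DimensionFour.
Context {R : realType} {n : nat}.
Variables (g : 'rV[R]_n -> 'M[R]_n) (u : 'rV[R]_4 -> 'rV[R]_n).
Implicit Types (x : 'rV[R]_4).

Local Notation h := (pullback_metric g u).
Local Notation F := (sfF g u).
Local Notation G := (sfG g u).
Local Notation Pbar := (schouten_bar g u).
Local Notation Jbar := (J_bar g u).

Definition pfaffian x : R :=
  8^-1 * normsq4 h (weyl h) x + Jbar x ^+ 2 - inner2 h Pbar Pbar x.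

Definition extrinsicQ x : R :=
  - laplacian h Jbar x - 2 * inner2 h Pbar Pbar x + 2 * Jbar x ^+ 2
  - laplacian h G x - 2 * inner2 h F F x + 2 * G x ^+ 2
  - 4 * inner2 h F Pbar x + 4 * G x * Jbar x
  - 2 / (n%:R - 4) * tr2 h (calB g u) x + 2 * sfD_normsq g u x.

End DimensionFour.

(* Main.v *)
(* Once the definitions are expanded, the four divergence terms cancel against
   those inside calI, and the identity reduces to a quadratic relation between
   F, G, calP and the Schouten tensor of the induced metric h.  That relation
   follows from the Gauss-Fialkow equation schouten h = calP - F and tr F = G.

   The Gauss equation is proved in matrix form.  Along Y let E be the matrix
   whose rows are the tangent vectors, M the ambient metric, A_alpha the matrix of
   the pulled-back ambient connection and S_alpha = d_alpha E + E A_alpha.  Then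
   K_alpha = S_alpha M E^T holds the Christoffel symbols of h of the first kind.
   Metric compatibility expresses d_alpha K_beta - d_beta K_alpha through the
   products S_beta M S_alpha^T and the commutator of the operators
   V |-> d_alpha V + V A_alpha, and that commutator is the ambient curvature. *)
Require Import Defs.
From HB Require Import structures.
From mathcomp Require Import all_boot all_order all_algebra.
From mathcomp Require Import all_classical all_reals all_analysis.
From mathcomp Require Import ring lra.

Set Implicit Arguments.
Unset Strict Implicit.
Unset Printing Implicit Defensive.

Import Order.TTheory GRing.Theory Num.Theory.
Import numFieldNormedType.Exports.

Local Open Scope classical_set_scope.
Local Open Scope ring_scope.

(** * Smooth functions on open sets *)

(** Partial derivatives are taken of total functions and carry geometric meaning only inside the
    chart images. Every identity is therefore proved on open sets, [U] in the chart of Y and [W] in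
    the chart of X, on which the data are smooth; smoothness licenses the Leibniz and chain rules,
    the exchange of second partials and the linearity of the divergence. The matrix form avoids
    differentiating the inverse of [h]: one differentiates the product of the Christoffel matrix
    with [h], which is K_alpha, and the inverse then occurs only in products K_beta h^-1 K_alpha^T.
    Such a product is exactly what turns S_beta M S_alpha^T into the inner product of the normal
    parts of S_beta and S_alpha, so no splitting into tangential and normal components is carried
    along. Gauss-Fialkow holds for every k > 2; dimension four matters for the final cancellation of
    coefficients. *)

Lemma near_eq_differentiable {R : numFieldType} {V W : normedModType R}
    (f g : V -> W) x :
  (\near x, f x = g x) -> differentiable f x -> differentiable g x.
Proof.
move=> fg df.
(* The first-order expansion of [f] at [x] also serves [g], since the remainder only sees values
   near [x]. Uniqueness of the differential then identifies ['d f x] with ['d g x]. *)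
have key : g \o shift x = cst (g x) + 'd f x +o_ 0 id.
  apply/eqaddoP => e e0.
  have /eqaddoP/(_ e e0) H := diff_locally df.
  have Hs : \forall y \near 0, f (y + x) = g (y + x).
    move: fg; rewrite (near_shift 0 x) subr0 => fg'.
    by apply: filterS fg' => y /=.
  near=> y.
  have : `|(f \o shift x - (cst (f x) + 'd f x)) y| <= e * `|y| by near: y.
  rewrite /= !fctE /= -(nbhs_singleton fg).
  suff -> : f (y + x) = g (y + x) by [].
  by near: y.
apply/diff_locallyP; rewrite (diff_unique (diff_continuous df) key).
by split; [exact: diff_continuous|exact: key].
Unshelve. all: by end_near. Qed.

Section SmoothFunctions.
Context {R : realType} {m : nat}.
Implicit Types (f g : 'rV[R]_m -> R) (x : 'rV[R]_m) (U : set 'rV[R]_m).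

Lemma pdE U f g i : open U -> (forall x, U x -> f x = g x) ->
  forall x, U x -> pd i f x = pd i g x.
Proof.
move=> oU fg x Ux; apply: near_eq_derive.
by apply: filterS (open_nbhs_nbhs (conj oU Ux)) => y /fg.
Qed.

(** Openness turns agreement on [U] into agreement near each of its points, hence into agreement of
    derivatives of every order. This is how a total function is traded for a formula valid only on
    [U]. *)
Lemma Ck_on_ext k U f g : open U -> (forall x, U x -> f x = g x) ->
  Ck_on k U f -> Ck_on k U g.
Proof.
move=> oU; elim: k f g => [|k IH] f g fg /=.
  move=> cf x Ux.
  have near_fg : {near x, f =1 g}.
    by apply: filterS (open_nbhs_nbhs (conj oU Ux)) => y /fg.
  rewrite /continuous_at /prop_for -(fg x Ux).
  exact: cvg_trans (near_eq_cvg near_fg) (cf x Ux).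
move=> [df cf]; split=> [x Ux|i].
  apply: near_eq_differentiable (df x Ux).
  by apply: filterS (open_nbhs_nbhs (conj oU Ux)) => y /fg.
by apply: IH (cf i); apply: pdE.
Qed.


Lemma Ck_onW k U f : Ck_on k.+1 U f -> Ck_on k U f.
Proof.
elim: k f => [|k IH] f [df cf]; first by move=> x /df/differentiable_continuous.
by split=> // i; apply: IH; apply: cf.
Qed.

Lemma Ck_on_cst k U (c : R) : open U -> Ck_on k U (fun=> c).
Proof.
move=> oU; elim: k c => [|k IH] c /=; first by move=> x _; exact: cst_continuous.
split=> [x _|i]; first exact: differentiable_cst.
apply: Ck_on_ext (IH 0) => // x _.
by rewrite /pd (_ : (fun=> c) = cst c) // derive_cst.
Qed.

Lemma Ck_onD k U f g : open U -> Ck_on k U f -> Ck_on k U g ->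
  Ck_on k U (fun x => f x + g x).
Proof.
move=> oU; elim: k f g => [|k IH] f g /=.
  by move=> cf cg x Ux; exact: (continuousD (cf x Ux) (cg x Ux)).
move=> [df cf] [dg cg]; split=> [x Ux|i].
  exact: (differentiableD (df x Ux) (dg x Ux)).
apply: Ck_on_ext (IH _ _ (cf i) (cg i)) => // x Ux.
rewrite /pd (_ : (fun y => f y + g y) = f + g) // deriveD //.
  exact/diff_derivable/df.
exact/diff_derivable/dg.
Qed.

Lemma pdM U f g i x : U x -> differentiable f x -> differentiable g x ->
  pd i (fun y => f y * g y) x = pd i f x * g x + f x * pd i g x.
Proof.
move=> Ux df dg.
rewrite /pd (_ : (fun y => f y * g y) = f * g) // deriveM; last 2 first.
- exact/diff_derivable.
- exact/diff_derivable.
by rewrite [RHS]addrC [pd i f x * _]mulrC.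
Qed.

Lemma Ck_onM k U f g : open U -> Ck_on k U f -> Ck_on k U g ->
  Ck_on k U (fun x => f x * g x).
Proof.
move=> oU; elim: k f g => [|k IH] f g.
  by move=> cf cg x Ux; exact: (continuousM (cf x Ux) (cg x Ux)).
move=> Cf Cg; have [df cf] := Cf; have [dg cg] := Cg; split=> [x Ux|i].
  exact: (differentiableM (df x Ux) (dg x Ux)).
apply: Ck_on_ext; last first.
- apply: Ck_onD => //; apply: IH.
  + exact: cf i.
  + exact: Ck_onW Cg.
  + exact: Ck_onW Cf.
  + exact: cg i.
- by move=> x Ux; rewrite (pdM _ Ux) //; [apply: df|apply: dg].
- by [].
Qed.

(** The derivative of the inverse is - f' f^-2, so order k + 1 follows from order k of the inverse
    itself. *)
Lemma Ck_onV k U f : open U -> (forall x, U x -> f x != 0) -> Ck_on k U f ->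
  Ck_on k U (fun x => (f x)^-1).
Proof.
move=> oU f0; elim: k => [|k IH] Cf.
  by move=> x Ux; exact: (continuousV (f0 x Ux) (Cf x Ux)).
have [df cf] := Cf; split=> [x Ux|i].
  exact: (differentiableV (df x Ux) (f0 x Ux)).
have CV := IH (Ck_onW Cf).
apply: (Ck_on_ext (f := fun x => (-1 * pd i f x) * ((f x)^-1 * (f x)^-1))) => //.
  move=> x Ux; rewrite /pd deriveV; [|exact: f0|exact/diff_derivable/df].
  rewrite expr2 invfM; transitivity (- ((f x)^-1 / f x) * pd i f x); last by [].
  by rewrite /pd; ring.
apply: Ck_onM => //; last exact: Ck_onM.
by apply: Ck_onM (Ck_on_cst _ _ oU) (cf i).
Qed.

Lemma smooth_on_ext U f g : open U -> (forall x, U x -> f x = g x) ->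
  smooth_on U f -> smooth_on U g.
Proof. by move=> oU fg Cf k; apply: Ck_on_ext (Cf k). Qed.

Lemma smooth_on_cst U (c : R) : open U -> smooth_on U (fun=> c).
Proof. by move=> oU k; apply: Ck_on_cst. Qed.

Lemma smooth_onD U f g : open U -> smooth_on U f -> smooth_on U g ->
  smooth_on U (fun x => f x + g x).
Proof. by move=> oU Cf Cg k; apply: Ck_onD. Qed.

Lemma smooth_onM U f g : open U -> smooth_on U f -> smooth_on U g ->
  smooth_on U (fun x => f x * g x).
Proof. by move=> oU Cf Cg k; apply: Ck_onM. Qed.

Lemma smooth_onN U f : open U -> smooth_on U f -> smooth_on U (fun x => - f x).
Proof.
move=> oU Cf; apply: (smooth_on_ext (f := fun x => -1 * f x)) => //.
  by move=> x _; rewrite mulN1r.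
by apply: smooth_onM => //; apply: smooth_on_cst.
Qed.

Lemma smooth_onV U f : open U -> (forall x, U x -> f x != 0) ->
  smooth_on U f -> smooth_on U (fun x => (f x)^-1).
Proof. by move=> oU f0 Cf k; apply: Ck_onV. Qed.

Lemma Ck_on_sum (I : Type) (r : seq I) (P : pred I)
    (F : I -> 'rV[R]_m -> R) k U : open U ->
  (forall i, P i -> Ck_on k U (F i)) ->
  Ck_on k U (fun x => \sum_(i <- r | P i) F i x).
Proof.
move=> oU CF; elim: r => [|i r IH].
  by apply: Ck_on_ext (Ck_on_cst _ 0 oU) => // x _; rewrite big_nil.
have [Pi|nPi] := boolP (P i).
  apply: Ck_on_ext (Ck_onD oU (CF i Pi) IH) => // x _.
  by rewrite big_cons Pi.
by apply: Ck_on_ext IH => // x _; rewrite big_cons (negbTE nPi).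
Qed.

Lemma smooth_on_sum (I : Type) (r : seq I) (P : pred I)
    (F : I -> 'rV[R]_m -> R) U : open U ->
  (forall i, P i -> smooth_on U (F i)) ->
  smooth_on U (fun x => \sum_(i <- r | P i) F i x).
Proof. by move=> oU CF k; apply: Ck_on_sum => // i Pi; apply: CF. Qed.

Lemma smooth_on_prod (I : Type) (r : seq I) (P : pred I)
    (F : I -> 'rV[R]_m -> R) U : open U ->
  (forall i, P i -> smooth_on U (F i)) ->
  smooth_on U (fun x => \prod_(i <- r | P i) F i x).
Proof.
move=> oU CF; elim: r => [|i r IH].
  by apply: smooth_on_ext (smooth_on_cst 1 oU) => // x _; rewrite big_nil.
have [Pi|nPi] := boolP (P i).
  apply: smooth_on_ext (smooth_onM oU (CF i Pi) IH) => // x _.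
  by rewrite big_cons Pi.
by apply: smooth_on_ext IH => // x _; rewrite big_cons (negbTE nPi).
Qed.

Lemma smooth_on_pd {V : normedModType R} U (f : 'rV[R]_m -> V) i :
  smooth_on U f -> smooth_on U (pd i f).
Proof. by move=> Cf k; have [_] := Cf k.+1; apply. Qed.

Lemma smooth_on_differentiable {V : normedModType R} U (f : 'rV[R]_m -> V) x :
  smooth_on U f -> U x -> differentiable f x.
Proof. by move=> Cf Ux; have [df _] := Cf 1; apply: df. Qed.

Lemma smooth_on_det U d (M : 'rV[R]_m -> 'M[R]_d) : open U ->
  (forall i j, smooth_on U (fun x => M x i j)) ->
  smooth_on U (fun x => \det (M x)).
Proof.
move=> oU CM; apply: smooth_on_sum => // s _; apply: smooth_onM => //.
  exact: smooth_on_cst.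
exact: smooth_on_prod.
Qed.

Lemma smooth_on_invmx U d (M : 'rV[R]_m -> 'M[R]_d) : open U ->
  (forall i j, smooth_on U (fun x => M x i j)) ->
  (forall x, U x -> M x \in unitmx) ->
  forall i j, smooth_on U (fun x => invmx (M x) i j).
Proof.
move=> oU CM uM i j.
(* Cramer's rule, available on [U] because the matrix is invertible there. *)
apply: (smooth_on_ext (f := fun x => (\det (M x))^-1 * cofactor (M x) j i)) => //.
  by move=> x Ux; rewrite /invmx uM // !mxE.
apply: smooth_onM => //.
  apply: smooth_onV => //; last exact: smooth_on_det.
  by move=> x Ux; have := uM x Ux; rewrite unitmxE unitfE.
apply: smooth_onM => //; first exact: smooth_on_cst.
apply: smooth_on_det => // a b.
by apply: smooth_on_ext (CM (lift j a) (lift i b)) => // x _; rewrite !mxE.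
Qed.

Lemma smooth_on_coord U d (v : 'rV[R]_m -> 'rV[R]_d) j : open U ->
  smooth_on U v -> smooth_on U (fun x => v x 0 j).
Proof.
move=> oU Cv k; have {Cv} := Cv k; elim: k v => [|k IH] v /=.
  move=> cv x Ux.
  exact: (continuous_comp (cv x Ux) (@coord_continuous _ _ _ 0 j (v x))).
move=> [dv cv]; split=> [x Ux|i].
  exact: (differentiable_comp (dv x Ux) (differentiable_coord (v x) 0 j)).
apply: Ck_on_ext (IH _ (cv i)) => // x Ux.
by rewrite /pd derive_mx ?mxE //; exact/diff_derivable/dv.
Qed.

End SmoothFunctions.

(** * Jacobians and the chain rule *)

Section ChainRule.
Context {R : realType} {k n : nat}.
Variables (u : 'rV[R]_k -> 'rV[R]_n).

Lemma jacobianE x alpha b : differentiable u x ->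
  'J u x alpha b = pd alpha (fun y => u y 0 b) x.
Proof.
move=> du; rewrite /pd.
have := derive_mx (diff_derivable (v := delta_mx 0 alpha) du).
rewrite deriveEjacobian // -rowE => /rowP/(_ b) E.
transitivity (row alpha ('J u x) 0 b); first by rewrite [RHS]mxE.
by rewrite E [LHS]mxE.
Qed.

Lemma pd_comp (f : 'rV[R]_n -> R) x alpha :
  differentiable u x -> differentiable f (u x) ->
  pd alpha (f \o u) x = \sum_b pd b f (u x) * 'J u x alpha b.
Proof.
move=> du df; rewrite /pd deriveE; last exact: differentiable_comp.
rewrite diff_comp //=.
have -> : 'd u x (delta_mx 0 alpha) = \sum_b 'J u x alpha b *: delta_mx 0 b.
  rewrite [LHS]row_sum_delta; apply: eq_bigr => b _; congr (_ *: _).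
  by rewrite -deriveE // deriveEjacobian // -rowE mxE.
rewrite linear_sum /=; apply: eq_bigr => b _.
by rewrite linearZ /= mulrC deriveE.
Qed.

(** Induction on the order with [f] generalised: a partial derivative of the composite is a sum of
    [pd b f] along [u], covered by the induction hypothesis, times partial derivatives of the
    components of [u]. *)
Lemma smooth_on_comp (f : 'rV[R]_n -> R) (U : set 'rV[R]_k) (W : set 'rV[R]_n) :
  open U -> (forall x, U x -> W (u x)) ->
  smooth_on U u -> smooth_on W f -> smooth_on U (fun x => f (u x)).
Proof.
move=> oU UW Cu Cf d; have {Cf} := Cf d; elim: d f => [|d IH] f.
  move=> cf x Ux; apply: (continuous_comp (Cu 0 x Ux)); exact/cf/UW.
move=> [df cf]; have du x (Ux : U x) : differentiable u x.
  exact: smooth_on_differentiable Cu Ux.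
split=> [x Ux|i].
  by apply: (differentiable_comp (du x Ux)); apply/df/UW.
apply: (Ck_on_ext (f := fun x => \sum_b pd b f (u x) * pd i (fun y => u y 0 b) x)) => //.
  move=> x Ux; rewrite -[RHS]/(pd i (f \o u) x) (pd_comp _ (du x Ux)).
    by apply: eq_bigr => b _; rewrite (jacobianE _ _ (du x Ux)).
  exact/df/UW.
apply: Ck_on_sum => // b _; apply: Ck_onM => //; first exact: IH (cf b).
have := smooth_on_coord b oU Cu; move=> /(_ d.+1)[_]; exact.
Qed.

End ChainRule.

(** * Symmetry of second partial derivatives *)

Section Clairaut.
Context {R : realType} {m : nat}.
Implicit Types (f : 'rV[R]_m -> R) (x p a b : 'rV[R]_m).

(** Restriction to a line makes the mean value theorem in one variable applicable to directional
    derivatives. *)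
Lemma is_derive_line f p a (s : R) : differentiable f (p + s *: a) ->
  is_derive s 1 (fun t => f (p + t *: a)) ('D_a f (p + s *: a)).
Proof.
move=> /(diff_derivable (v := a)) df.
have E : (fun h : R => h^-1 *: (f (p + (h *: (1 : R) + s) *: a) - f (p + s *: a)))
  = (fun h : R => h^-1 *: (f (h *: a + (p + s *: a)) - f (p + s *: a))).
  apply/funext => h; congr (_ *: (f _ - _)).
  by rewrite [h *: 1]mulr1 scalerDl addrCA.
apply: DeriveDef; first by rewrite /derivable E.
by rewrite /derive E.
Qed.

(** The left side is [phi e - phi 0], where [phi] is the increment of [f] along [b]. The mean value
    theorem along [a] yields [s]; applied again along [b] to [pd i f], it yields [t]. *)
Lemma second_difference f (i j : 'I_m) x (e : R) :
  let a := delta_mx 0 i in let b := delta_mx 0 j in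
  0 < e ->
  (forall s t, 0 <= s <= e -> 0 <= t <= e ->
    differentiable f (x + s *: a + t *: b) /\
    differentiable (pd i f) (x + s *: a + t *: b)) ->
  exists s t, [/\ 0 <= s <= e, 0 <= t <= e &
    f (x + e *: a + e *: b) - f (x + e *: a) - (f (x + e *: b) - f x)
    = e * e * pd j (pd i f) (x + s *: a + t *: b)].
Proof.
move=> a b e0 df.
have e00 : (0 : R) <= 0 <= e by rewrite lexx ltW.
have eee : 0 <= e <= e by rewrite lexx ltW.
pose phi s := f (x + e *: b + s *: a) - f (x + s *: a).
have dphi s : 0 <= s <= e ->
    is_derive s 1 phi (pd i f (x + e *: b + s *: a) - pd i f (x + s *: a)).
  move=> se; apply: is_deriveB; apply: is_derive_line.
    by have [+ _] := df s e se eee; rewrite addrAC.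
  by have [+ _] := df s 0 se e00; rewrite scale0r addr0.
have itvW s : s \in `]0, e[%R -> 0 <= s <= e.
  by rewrite in_itv /= => /andP[/ltW -> /ltW ->].
have cts (g dg : R -> R) : (forall s, 0 <= s <= e -> is_derive s 1 g (dg s)) ->
    {within `[0, e], continuous g}.
  move=> dg'; apply: derivable_within_continuous => s.
  by rewrite in_itv /= => se; have [] := dg' s se.
have [s sI Es] := MVT e0 (fun s sI => dphi s (itvW s sI)) (cts _ _ dphi).
have se := itvW s sI.
pose psi t := pd i f (x + s *: a + t *: b).
have dpsi t : 0 <= t <= e ->
    is_derive t 1 psi (pd j (pd i f) (x + s *: a + t *: b)).
  move=> te; apply: (is_derive_line (f := pd i f)).
  by have [_] := df s t se te.
have [t tI Et] := MVT e0 (fun t tI => dpsi t (itvW t tI)) (cts _ _ dpsi).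
exists s, t; split; [by []|exact: itvW|].
move: Es; rewrite /phi !scale0r !addr0 subr0 => Es.
move: Et; rewrite /psi !scale0r !addr0 subr0 => Et.
rewrite (addrAC x (e *: a)) Es (addrAC x (e *: b)) Et mulrC mulrA.
by rewrite mulrAC mulrC mulrA.
Qed.

Lemma dist_halves_absurd (A B c : R) :
  `|A - c| < `|A - B| / 2 -> `|B - c| < `|A - B| / 2 -> False.
Proof.
move=> HA HB; have := ler_distD c A B; rewrite leNgt => /negP; apply.
by rewrite [ltRHS]splitr ltrD // distrC.
Qed.

(* By two applications of the mean value theorem, the same second difference is a
   value of either mixed derivative near x. *)
Lemma pd_comm U f (i j : 'I_m) x : open U -> smooth_on U f -> U x ->
  pd i (pd j f) x = pd j (pd i f) x.
Proof.
move=> oU Cf Ux; apply/eqP; apply: contraT => neq.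
set A := pd i (pd j f) x in neq *; set B := pd j (pd i f) x in neq *.
pose eta := `|A - B| / 2.
have eta0 : 0 < eta by rewrite divr_gt0 // normr_gt0 subr_eq0.
have cA := smooth_on_pd i (smooth_on_pd j Cf) 0 x Ux.
have cB := smooth_on_pd j (smooth_on_pd i Cf) 0 x Ux.
have nA : \forall y \near x, `|A - pd i (pd j f) y| < eta.
  by move/cvgrPdist_lt: cA; apply.
have nB : \forall y \near x, `|B - pd j (pd i f) y| < eta.
  by move/cvgrPdist_lt: cB; apply.
have nU : \forall y \near x, U y by exact: open_nbhs_nbhs.
have [r /= r0 Hr] := (nbhs_ballP _ _).1 (filterI nU (filterI nA nB)).
pose a : 'rV[R]_m := delta_mx 0 i; pose b : 'rV[R]_m := delta_mx 0 j.
(* With this side length the whole square spanned by [e *: a] and [e *: b] stays in the ball of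
   radius [r]; the added 1 makes the bound strict and the denominator positive. *)
pose e := r / (`|a| + `|b| + 1).
have den0 : 0 < `|a| + `|b| + 1 by rewrite ltr_wpDl // addr_ge0.
have e0 : 0 < e by rewrite divr_gt0.
have inb s t (se : 0 <= s <= e) (te : 0 <= t <= e) : ball x r (x + s *: a + t *: b).
  rewrite -ball_normE /ball_ /= -addrA opprD addNKr normrN.
  apply: le_lt_trans (ler_normD _ _) _; rewrite !normrZ.
  move/andP: se => [s0 se]; move/andP: te => [t0 te].
  rewrite !ger0_norm //.
  apply: (@le_lt_trans _ _ (e * (`|a| + `|b|))).
    by rewrite mulrDr lerD // ler_wpM2r.
  by rewrite /e mulrAC ltr_pdivrMr // ltr_pM2l // ltrDl.
have [s [t [se te E1]]] : exists s t, [/\ 0 <= s <= e, 0 <= t <= e &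
    f (x + e *: a + e *: b) - f (x + e *: a) - (f (x + e *: b) - f x)
    = e * e * pd j (pd i f) (x + s *: a + t *: b)].
  apply: second_difference => // s t se te.
  have [Uy _] := Hr _ (inb s t se te); split.
    exact: smooth_on_differentiable Cf Uy.
  exact: smooth_on_differentiable (smooth_on_pd i Cf) Uy.
have inb' s' t' : 0 <= s' <= e -> 0 <= t' <= e -> ball x r (x + s' *: b + t' *: a).
  by move=> ? ?; rewrite addrAC; apply: inb.
have [s' [t' [se' te' E2]]] : exists s t, [/\ 0 <= s <= e, 0 <= t <= e &
    f (x + e *: b + e *: a) - f (x + e *: b) - (f (x + e *: a) - f x)
    = e * e * pd i (pd j f) (x + s *: b + t *: a)].
  apply: second_difference => // s' t' se' te'.
  have [Uy _] := Hr _ (inb' s' t' se' te'); split.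
    exact: smooth_on_differentiable Cf Uy.
  exact: smooth_on_differentiable (smooth_on_pd j Cf) Uy.
have [_ [_ HB]] := Hr _ (inb s t se te).
have [_ [HA _]] := Hr _ (inb' s' t' se' te').
(* Both routes reach the same opposite corner, so the two second differences coincide, and
   cancelling [e * e] identifies the two values. *)
have EAB : pd i (pd j f) (x + s' *: b + t' *: a)
    = pd j (pd i f) (x + s *: a + t *: b).
  apply: (mulfI (x := e * e)); first by rewrite mulf_neq0 // gt_eqF.
  have swap : forall p q v w : R, p - q - (v - w) = p - v - (q - w).
    by move=> *; ring.
  by apply: etrans (esym E2) _; apply: etrans _ E1; rewrite (addrAC x (e *: b)); exact: swap.
rewrite EAB in HA.
apply: False_ind; apply: (dist_halves_absurd (A := A) (B := B)); [exact: HA|exact: HB].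
Qed.

End Clairaut.

(** * Riemannian metrics in coordinates *)

(** Invertibility stands in for positivity: it is what the Levi-Civita calculus needs, and it can be
    stated alike for the ambient metric and the induced one. Positivity serves to establish it. *)
Definition metric_on {R : realType} {m : nat} (W : set 'rV[R]_m)
    (g : 'rV[R]_m -> 'M[R]_m) : Prop :=
  [/\ forall i j, smooth_on W (fun x => g x i j),
      forall x, W x -> (g x)^T = g x &
      forall x, W x -> g x \in unitmx].

Ltac smooth_step := first
  [ assumption
  | apply: smooth_onD; [assumption| |]
  | apply: smooth_onM; [assumption| |]
  | apply: smooth_onN; [assumption|]
  | apply: smooth_on_sum; [assumption|move=> ? _]
  | apply: smooth_on_pd
  | apply: smooth_on_cst; assumption ].

Section MetricSmooth.
Context {R : realType} {m : nat}.
Variables (W : set 'rV[R]_m) (g : 'rV[R]_m -> 'M[R]_m).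
Hypotheses (oW : open W) (gW : metric_on W g).
Implicit Types (a b c d : 'I_m).

Lemma smooth_metric a b : smooth_on W (fun x => g x a b).
Proof. by case: gW. Qed.

Lemma smooth_ginv a b : smooth_on W (ginv g a b).
Proof. by case: gW => Cg _ ug; apply: smooth_on_invmx. Qed.

Lemma smooth_christoffel c a b : smooth_on W (christoffel g c a b).
Proof.
rewrite /christoffel.
by repeat first [apply: smooth_ginv|apply: smooth_metric|smooth_step].
Qed.

Lemma smooth_cov1 T a b : (forall b, smooth_on W (T b)) ->
  smooth_on W (cov1 g T a b).
Proof.
move=> CT; rewrite /cov1.
by repeat first [apply: CT|apply: smooth_christoffel|smooth_step].
Qed.

Lemma smooth_cov2 T a b c : (forall b c, smooth_on W (T b c)) ->
  smooth_on W (cov2 g T a b c).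
Proof.
move=> CT; rewrite /cov2.
by repeat first [apply: CT|apply: smooth_christoffel|smooth_step].
Qed.

Lemma smooth_riem_up a b c d : smooth_on W (riem_up g a b c d).
Proof.
have Ccoframe e c' : smooth_on W (coframe e c') by apply: smooth_on_cst.
rewrite /riem_up; apply: smooth_onD => //; last apply: smooth_onN => //.
  by apply: smooth_cov2 => b' c'; apply: smooth_cov1.
by apply: smooth_cov2 => b' c'; apply: smooth_cov1.
Qed.

Lemma smooth_tr2 T : (forall a b, smooth_on W (T a b)) -> smooth_on W (tr2 g T).
Proof.
move=> CT; rewrite /tr2.
by repeat first [apply: CT|apply: smooth_ginv|smooth_step].
Qed.

Lemma smooth_schouten a b : smooth_on W (schouten g a b).
Proof.
have Cricci a' b' : smooth_on W (ricci g a' b').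
  by rewrite /ricci; repeat first [apply: smooth_riem_up|smooth_step].
have CJ : smooth_on W (schoutenJ g).
  by rewrite /schoutenJ; smooth_step; [apply: smooth_tr2|smooth_step].
by rewrite /schouten; repeat first
  [apply: Cricci|apply: CJ|apply: smooth_metric|smooth_step].
Qed.

Lemma smooth_weyl a b c d : smooth_on W (weyl g a b c d).
Proof.
by rewrite /weyl /riem; repeat first [apply: smooth_riem_up
  |apply: smooth_schouten|apply: smooth_metric|smooth_step].
Qed.

Lemma smooth_cotton a b c : smooth_on W (cotton g a b c).
Proof.
rewrite /cotton; smooth_step; last smooth_step;
  by apply: smooth_cov2 => *; apply: smooth_schouten.
Qed.

End MetricSmooth.

(** * The extrinsic tensors are smooth *)

Section ImmersionSmooth.
Context {R : realType} {k n : nat}.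
Variables (U : set 'rV[R]_k) (W : set 'rV[R]_n).
Variables (g : 'rV[R]_n -> 'M[R]_n) (u : 'rV[R]_k -> 'rV[R]_n).
Hypotheses (oU : open U) (oW : open W) (gW : metric_on W g).
Hypotheses (Cu : smooth_on U u) (uUW : forall x, U x -> W (u x)).
Hypothesis hunit : forall x, U x -> pullback_metric g u x \in unitmx.
Local Notation h := (pullback_metric g u).
Implicit Types (alpha beta gamma delta : 'I_k) (a b c d : 'I_n).

(** An entry of the Jacobian matrix is a partial derivative of a coordinate only where [u] is
    differentiable, whence the passage through [smooth_on_ext]. *)
Lemma smooth_tangent alpha a : smooth_on U (tangent u alpha a).
Proof.
apply: smooth_on_ext (smooth_on_pd alpha (smooth_on_coord a oU Cu)) => // x Ux.
by rewrite /tangent jacobianE //; exact: smooth_on_differentiable Cu Ux.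
Qed.

Lemma smooth_along (f : 'rV[R]_n -> R) : smooth_on W f ->
  smooth_on U (fun x => f (u x)).
Proof. exact: smooth_on_comp. Qed.

Lemma pullback_metricE alpha beta x :
  h x alpha beta
  = \sum_b (\sum_a tangent u alpha a x * g (u x) a b) * tangent u beta b x.
Proof.
rewrite /pullback_metric mxE; apply: eq_bigr => b _.
by rewrite [X in X * _]mxE [X in _ * X]mxE.
Qed.

Ltac ambient := first
  [ exact: (smooth_along (smooth_metric gW _ _))
  | exact: (smooth_along (smooth_christoffel oW gW _ _ _))
  | exact: (smooth_along (smooth_schouten oW gW _ _))
  | exact: (smooth_along (smooth_weyl oW gW _ _ _ _))
  | exact: (smooth_along (smooth_cotton oW gW _ _ _))
  | exact: (smooth_along (smooth_ginv oW gW _ _))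
  | exact: smooth_tangent ].

(** Makes all the intrinsic lemmas available for the induced metric. *)
Lemma pullback_metric_on : metric_on U h.
Proof.
case: (gW) => _ symg _; split=> // [alpha beta|x Ux].
  apply: smooth_on_ext (_ : smooth_on U (fun x => \sum_b
    (\sum_a tangent u alpha a x * g (u x) a b) * tangent u beta b x)) => //.
    by move=> x _; rewrite pullback_metricE.
  by repeat first [ambient|smooth_step].
by rewrite /pullback_metric !trmx_mul trmxK (symg _ (uUW Ux)) mulmxA.
Qed.

Let hU := pullback_metric_on.

Lemma normal_projE a b x : normal_proj g u x a b = (a == b)%:R
  - \sum_c (\sum_delta (\sum_gamma tangent u gamma a x * ginv h gamma delta x)
                        * tangent u delta c x) * g (u x) c b.
Proof.
rewrite /normal_proj mxE [X in X + _]mxE [X in _ + X]mxE; congr (_ - _).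
rewrite mxE; apply: eq_bigr => c _; congr (_ * _).
rewrite mxE; apply: eq_bigr => delta _; congr (_ * _).
rewrite mxE; apply: eq_bigr => gamma _; congr (_ * _).
by rewrite mxE.
Qed.

Lemma smooth_normal_proj a b : smooth_on U (fun x => normal_proj g u x a b).
Proof.
apply: smooth_on_ext (_ : smooth_on U (fun x => (a == b)%:R
  - \sum_c (\sum_delta (\sum_gamma tangent u gamma a x * ginv h gamma delta x)
                        * tangent u delta c x) * g (u x) c b)) => //.
  by move=> x _; rewrite normal_projE.
by repeat first [ambient|exact: smooth_ginv oU hU _ _|smooth_step].
Qed.

Lemma smooth_sff alpha beta a : smooth_on U (sff g u alpha beta a).
Proof.
rewrite /sff /sff_up.
by repeat first [ambient|exact: smooth_normal_proj|smooth_step].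
Qed.

Ltac extrinsic := first
  [ ambient | exact: smooth_normal_proj | exact: smooth_sff
  | exact: smooth_ginv oU hU _ _ | exact: smooth_metric hU _ _ ].

Lemma smooth_mean_curv a : smooth_on U (mean_curv g u a).
Proof. by rewrite /mean_curv; repeat first [extrinsic|smooth_step]. Qed.

Lemma smooth_sff0 alpha beta a : smooth_on U (sff0 g u alpha beta a).
Proof.
by rewrite /sff0; repeat first [extrinsic|exact: smooth_mean_curv|smooth_step].
Qed.

Lemma smooth_sfG : smooth_on U (sfG g u).
Proof.
rewrite /sfG /sff0_normsq /weyl_trtr /tan4.
by repeat first [extrinsic|exact: smooth_sff0|smooth_step].
Qed.

Lemma smooth_calC alpha : smooth_on U (calC g u alpha).
Proof.
rewrite /calC /calC3 /mean_curv_up.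
by repeat first [extrinsic|exact: smooth_mean_curv|smooth_step].
Qed.

Lemma smooth_sfD_sff0 alpha : smooth_on U (sfD_sff0 g u alpha).
Proof.
rewrite /sfD_sff0 /sfD /cov_normal.
by repeat first [extrinsic|exact: smooth_mean_curv|exact: smooth_sff0|smooth_step].
Qed.

Lemma smooth_J_bar : smooth_on U (J_bar g u).
Proof. by apply: smooth_tr2 => // alpha beta; exact: smooth_schouten oU hU _ _. Qed.

End ImmersionSmooth.

(** * The Levi-Civita connection in matrix form *)

Section MatrixDerivative.
Context {R : realType} {m : nat}.
Implicit Types (U : set 'rV[R]_m) (x : 'rV[R]_m) (i : 'I_m).

(** Taken entrywise, so that each matrix rule reduces to the scalar one. *)
Definition mpd {p q} i (M : 'rV[R]_m -> 'M[R]_(p, q)) x : 'M[R]_(p, q) :=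
  \matrix_(r, s) pd i (fun y => M y r s) x.

Definition smooth_mx {p q} U (M : 'rV[R]_m -> 'M[R]_(p, q)) : Prop :=
  forall r s, smooth_on U (fun x => M x r s).

Lemma mpd_entry {p q} i (M : 'rV[R]_m -> 'M[R]_(p, q)) x r s :
  mpd i M x r s = pd i (fun y => M y r s) x.
Proof. by rewrite mxE. Qed.

Lemma pdD U (f f' : 'rV[R]_m -> R) i x : U x -> smooth_on U f -> smooth_on U f' ->
  pd i (fun y => f y + f' y) x = pd i f x + pd i f' x.
Proof.
move=> Ux Cf Cf'; rewrite /pd (_ : (fun y => f y + f' y) = f + f') // deriveD //.
  exact/diff_derivable/(smooth_on_differentiable Cf Ux).
exact/diff_derivable/(smooth_on_differentiable Cf' Ux).
Qed.

Lemma pd_sum (I : Type) (r : seq I) (F : I -> 'rV[R]_m -> R) U i x :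
  open U -> U x -> (forall j, smooth_on U (F j)) ->
  pd i (fun y => \sum_(j <- r) F j y) x = \sum_(j <- r) pd i (F j) x.
Proof.
move=> oU Ux CF; elim: r => [|j r IH].
  rewrite big_nil /pd (_ : (fun y => _) = cst 0) ?derive_cst //.
  by apply/funext => y; rewrite big_nil.
rewrite big_cons -IH -(pdD _ Ux) //; last by apply: smooth_on_sum.
by congr (pd i _ x); apply/funext => y; rewrite big_cons.
Qed.

Lemma pdN (f : 'rV[R]_m -> R) U i x : U x -> smooth_on U f ->
  pd i (fun y => - f y) x = - pd i f x.
Proof.
move=> Ux Cf; rewrite /pd (_ : (fun y => - f y) = - f) // deriveN //.
exact/diff_derivable/(smooth_on_differentiable Cf Ux).
Qed.

Lemma mpdE {p q} U (M N : 'rV[R]_m -> 'M[R]_(p, q)) i x : open U -> U x ->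
  (forall y, U y -> M y = N y) -> mpd i M x = mpd i N x.
Proof.
move=> oU Ux MN; apply/matrixP => r s; rewrite !mxE.
by apply: (pdE i oU) => // y Uy; rewrite MN.
Qed.

Lemma smooth_mpd {p q} U (M : 'rV[R]_m -> 'M[R]_(p, q)) i : open U ->
  smooth_mx U M -> smooth_mx U (mpd i M).
Proof.
move=> oU CM r s; apply: smooth_on_ext (smooth_on_pd i (CM r s)) => // x _.
by rewrite mxE.
Qed.

Lemma smooth_mxD {p q} U (M N : 'rV[R]_m -> 'M[R]_(p, q)) : open U ->
  smooth_mx U M -> smooth_mx U N -> smooth_mx U (fun x => M x + N x).
Proof.
move=> oU CM CN r s; apply: smooth_on_ext (smooth_onD oU (CM r s) (CN r s)) => //.
by move=> x _; rewrite mxE.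
Qed.

Lemma smooth_mxM {p q l} U (M : 'rV[R]_m -> 'M[R]_(p, q))
    (N : 'rV[R]_m -> 'M[R]_(q, l)) : open U ->
  smooth_mx U M -> smooth_mx U N -> smooth_mx U (fun x => M x *m N x).
Proof.
move=> oU CM CN r s.
apply: smooth_on_ext (_ : smooth_on U (fun x => \sum_t M x r t * N x t s)) => //.
  by move=> x _; rewrite mxE.
by apply: smooth_on_sum => // t _; apply: smooth_onM.
Qed.

Lemma smooth_mx_tr {p q} U (M : 'rV[R]_m -> 'M[R]_(p, q)) : open U ->
  smooth_mx U M -> smooth_mx U (fun x => (M x)^T).
Proof.
by move=> oU CM r s; apply: smooth_on_ext (CM s r) => // x _; rewrite mxE.
Qed.

Lemma mpdD {p q} U (M N : 'rV[R]_m -> 'M[R]_(p, q)) i x : U x ->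
  smooth_mx U M -> smooth_mx U N ->
  mpd i (fun y => M y + N y) x = mpd i M x + mpd i N x.
Proof.
move=> Ux CM CN; apply/matrixP => r s; rewrite !mxE -(pdD _ Ux) //.
by congr (pd i _ x); apply/funext => y; rewrite mxE.
Qed.

Lemma mpdM {p q l} U (M : 'rV[R]_m -> 'M[R]_(p, q))
    (N : 'rV[R]_m -> 'M[R]_(q, l)) i x : open U -> U x ->
  smooth_mx U M -> smooth_mx U N ->
  mpd i (fun y => M y *m N y) x = mpd i M x *m N x + M x *m mpd i N x.
Proof.
move=> oU Ux CM CN; apply/matrixP => r s; rewrite !mxE.
transitivity (pd i (fun y => \sum_t M y r t * N y t s) x).
  by congr (pd i _ x); apply/funext => y; rewrite mxE.
rewrite (pd_sum _ _ oU Ux); last by move=> t; apply: smooth_onM.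
rewrite -big_split /=; apply: eq_bigr => t _; rewrite !mxE (pdM _ Ux) //.
  exact: (smooth_on_differentiable (CM r t) Ux).
exact: (smooth_on_differentiable (CN t s) Ux).
Qed.

Lemma mpd_tr {p q} (M : 'rV[R]_m -> 'M[R]_(p, q)) i x :
  mpd i (fun y => (M y)^T) x = (mpd i M x)^T.
Proof.
apply/matrixP => r s; rewrite !mxE.
by congr (pd i _ x); apply/funext => y; rewrite mxE.
Qed.

Lemma mpd_comm {p q} U (M : 'rV[R]_m -> 'M[R]_(p, q)) i (j : 'I_m) x : open U -> U x ->
  smooth_mx U M -> mpd i (mpd j M) x = mpd j (mpd i M) x.
Proof.
move=> oU Ux CM; apply/matrixP => r s; rewrite [LHS]mxE [RHS]mxE.
transitivity (pd i (pd j (fun y => M y r s)) x).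
  by congr (pd i _ x); apply/funext => y; rewrite mxE.
rewrite (pd_comm _ _ oU (CM r s) Ux).
by congr (pd j _ x); apply/funext => y; rewrite mxE.
Qed.

End MatrixDerivative.

Section LeviCivita.
Context {R : realType} {m : nat}.
Variables (W : set 'rV[R]_m) (g : 'rV[R]_m -> 'M[R]_m).
Hypotheses (oW : open W) (gW : metric_on W g).
Implicit Types (a b c d : 'I_m) (x : 'rV[R]_m).

(** The row index is the lower one: for a row vector v of components v^c, the product of v with this
    matrix is the connection term of its covariant derivative. *)
Definition christoffel_mx a x : 'M[R]_m :=
  \matrix_(c, d) christoffel g d a c x.

Definition riem_mx a b x : 'M[R]_m := \matrix_(c, d) riem_up g a b c d x.

Lemma christoffel_mx_entry a x c d :
  christoffel_mx a x c d = christoffel g d a c x.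
Proof. by rewrite mxE. Qed.

Lemma riem_mx_entry a b x c d : riem_mx a b x c d = riem_up g a b c d x.
Proof. by rewrite mxE. Qed.

Lemma smooth_christoffel_mx a : smooth_mx W (christoffel_mx a).
Proof.
move=> c d; apply: smooth_on_ext (smooth_christoffel oW gW d a c) => // x _.
by rewrite mxE.
Qed.

Lemma metric_symE a b x : W x -> g x a b = g x b a.
Proof. by case: gW => _ symg _ Wx; rewrite -{1}(symg x Wx) mxE. Qed.

Lemma pd_metric_sym a b c x : W x ->
  pd c (fun y => g y a b) x = pd c (fun y => g y b a) x.
Proof. by move=> Wx; apply: (pdE c oW) => // y Wy; exact: metric_symE. Qed.

Lemma christoffel_sym c a b x : W x -> christoffel g c a b x = christoffel g c b a x.
Proof.
move=> Wx; rewrite /christoffel; congr (_ * _); apply: eq_bigr => d _.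
by congr (_ * _); rewrite (pd_metric_sym a b) // [X in X - _]addrC.
Qed.

Lemma ginvK a b x : W x -> \sum_c g x a c * ginv g c b x = (a == b)%:R.
Proof.
case: gW => _ _ ug Wx; have := mulmxV (ug x Wx).
by move/matrixP/(_ a b); rewrite !mxE.
Qed.

Lemma ginv_sym a b x : W x -> ginv g a b x = ginv g b a x.
Proof.
case: gW => _ symg _ Wx.
by rewrite /ginv -{1}(symg x Wx) -trmx_inv mxE.
Qed.

(** Lowering the upper index cancels the inverse metric in [christoffel] and leaves the symbols of
    the first kind. *)
Lemma christoffel_lower a b d x : W x ->
  (christoffel_mx a x *m g x) b d
  = 2^-1 * (pd a (fun y => g y d b) x + pd b (fun y => g y d a) x
            - pd d (fun y => g y a b) x).
Proof.
move=> Wx; rewrite mxE.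
pose T e := pd a (fun y => g y e b) x + pd b (fun y => g y e a) x
            - pd e (fun y => g y a b) x.
transitivity (\sum_e 2^-1 * T e * \sum_c g x d c * ginv g c e x).
  rewrite (eq_bigr (fun c => \sum_e 2^-1 * T e * (g x d c * ginv g c e x))).
    by rewrite exchange_big; apply: eq_bigr => e _; rewrite mulr_sumr.
  move=> c _; rewrite mxE /christoffel mulr_sumr mulr_suml; apply: eq_bigr => e _.
  by rewrite (metric_symE c d Wx) -/(T e); ring.
rewrite (bigD1 d) //= (ginvK _ _ Wx) eqxx mulr1 [X in _ + X]big1 ?addr0 //.
by move=> e ed; rewrite (ginvK _ _ Wx) eq_sym (negbTE ed) mulr0.
Qed.

(** Metric compatibility of the connection: on adding the first-kind symbols with the outer indices
    exchanged, all derivatives but the one in direction [a] cancel. *)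
Lemma mpd_metric a x : W x ->
  mpd a g x = christoffel_mx a x *m g x + (christoffel_mx a x *m g x)^T.
Proof.
move=> Wx; apply/matrixP => b d; rewrite [in RHS]mxE [X in _ + X]mxE.
rewrite !christoffel_lower // mxE.
by rewrite (pd_metric_sym b d) // (pd_metric_sym a b) // (pd_metric_sym a d) //;
  lra.
Qed.

Local Opaque pd christoffel mpd christoffel_mx riem_mx.

(** The curvature is defined through 1-forms, on which the connection acts with the opposite sign;
    this is the origin of the overall minus. A coordinate 1-form has constant components, so its
    first covariant derivative is a Christoffel symbol, and the terms in the Christoffel symbol of
    the two derivative indices cancel by its symmetry. *)
Lemma riem_mxE a b x : W x ->
  riem_mx a b x = - (mpd a (christoffel_mx b) x - mpd b (christoffel_mx a) x
    + christoffel_mx b x *m christoffel_mx a x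
    - christoffel_mx a x *m christoffel_mx b x).
Proof.
move=> Wx; apply/matrixP => c d.
have cov1_coframe b' c' :
    cov1 g (coframe d) b' c' = (fun y => - christoffel g d b' c' y).
  apply/funext => y; rewrite /cov1 (_ : coframe d c' = cst (c' == d)%:R) //.
  rewrite [pd _ _ _]derive_cst sub0r (bigD1 d) //= /coframe eqxx mulr1 big1 ?addr0 //.
  by move=> e /negbTE ->; rewrite mulr0.
have pdE' a' b' : pd a' (cov1 g (coframe d) b' c) x
    = - mpd a' (christoffel_mx b') x c d.
  rewrite cov1_coframe (pdN _ Wx (smooth_christoffel oW gW d b' c)) mpd_entry.
  by congr (- pd a' _ x); apply/funext => y; rewrite christoffel_mx_entry.
rewrite riem_mx_entry /riem_up /cov2 (pdE' a b) (pdE' b a).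
have ME a' b' : (christoffel_mx a' x *m christoffel_mx b' x) c d
    = \sum_e christoffel g e a' c x * christoffel g d b' e x.
  by rewrite mxE; apply: eq_bigr => e _; rewrite !christoffel_mx_entry.
have S2 a' b' : \sum_e christoffel g e a' c x * cov1 g (coframe d) b' e x
    = - (christoffel_mx a' x *m christoffel_mx b' x) c d.
  by rewrite ME -sumrN; apply: eq_bigr => e _; rewrite cov1_coframe mulrN.
have S1 : \sum_e christoffel g e a b x * cov1 g (coframe d) e c x
    = \sum_e christoffel g e b a x * cov1 g (coframe d) e c x.
  by apply: eq_bigr => e _; rewrite christoffel_sym.
have alg (p q v w z : R) :
  - p - z - (- v) - (- q - z - (- w)) = - (p - q + w - v) by ring.
have entry (A B C D : 'M[R]_m) :
    (- (A - B + C - D)) c d = - (A c d - B c d + C c d - D c d).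
  by rewrite !mxE.
apply: etrans _ (esym (entry _ _ _ _)); apply: etrans (alg _ _ _ _ _).
by congr (_ - _ - _ - (_ - _ - _)); [exact: S2|exact: esym S1|exact: S2].
Qed.

End LeviCivita.

(** * The Gauss equation *)

Section Gauss.
Local Opaque pd christoffel mpd christoffel_mx riem_mx.
Context {R : realType} {k n : nat}.
Variables (U : set 'rV[R]_k) (W : set 'rV[R]_n).
Variables (g : 'rV[R]_n -> 'M[R]_n) (u : 'rV[R]_k -> 'rV[R]_n).
Hypotheses (oU : open U) (oW : open W) (gW : metric_on W g).
Hypotheses (Cu : smooth_on U u) (uUW : forall x, U x -> W (u x)).
Hypothesis hunit : forall x, U x -> pullback_metric g u x \in unitmx.
Local Notation h := (pullback_metric g u).
Local Notation e := (tangent u).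
Implicit Types (alpha beta gamma delta : 'I_k) (a b c d : 'I_n) (x : 'rV[R]_k).

Let hU : metric_on U h := pullback_metric_on oU gW Cu uUW hunit.

(** In the notation of the overview, [jac], [ambient_metric], [conn], [sff_full] and [conn_lower]
    are E, M, A_alpha, S_alpha and K_alpha. *)
Definition jac x : 'M[R]_(k, n) := 'J u x.

Definition ambient_metric x : 'M[R]_n := g (u x).

(* Acts on row vectors: the covariant derivative along Y of a vector field v is
   [mpd alpha v x + v x *m conn alpha x]. *)
Definition conn alpha x : 'M[R]_n :=
  \sum_c e alpha c x *: christoffel_mx g c (u x).

(* Row beta is nabla_{d_alpha} d_beta, before projection to NY. *)
Definition sff_full alpha x : 'M[R]_(k, n) :=
  mpd alpha jac x + jac x *m conn alpha x.

Definition conn_lower alpha x : 'M[R]_k :=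
  sff_full alpha x *m ambient_metric x *m (jac x)^T.

Let smooth_jac : smooth_mx U jac.
Proof. by move=> alpha a; exact: smooth_tangent oU Cu alpha a. Qed.

Let smooth_ambient_metric : smooth_mx U ambient_metric.
Proof. by move=> a b; exact: smooth_along (smooth_metric gW a b). Qed.

Lemma conn_entry alpha x d a :
  conn alpha x d a = \sum_c e alpha c x * christoffel g a c d (u x).
Proof.
rewrite /conn summxE; apply: eq_bigr => c _.
by rewrite [LHS]mxE christoffel_mx_entry.
Qed.

Let smooth_conn alpha : smooth_mx U (conn alpha).
Proof.
move=> d a; apply: smooth_on_ext (_ : smooth_on U (fun x => \sum_c
    e alpha c x * christoffel g a c d (u x))) => //.
  by move=> x _; rewrite conn_entry.
apply: smooth_on_sum => // c _; apply: smooth_onM => //.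
  exact: smooth_tangent.
exact: smooth_along (smooth_christoffel oW gW _ _ _).
Qed.

Let smooth_sff_full alpha : smooth_mx U (sff_full alpha).
Proof.
by apply: smooth_mxD => //; [apply: smooth_mpd|apply: smooth_mxM].
Qed.

Lemma pd_along (f : 'rV[R]_n -> R) alpha x : U x -> smooth_on W f ->
  pd alpha (fun y => f (u y)) x = \sum_c e alpha c x * pd c f (u x).
Proof.
move=> Ux Cf; rewrite -[LHS]/(pd alpha (f \o u) x) pd_comp.
- by apply: eq_bigr => c _; rewrite mulrC.
- exact: smooth_on_differentiable Cu Ux.
- exact: smooth_on_differentiable Cf (uUW Ux).
Qed.

Lemma mpd_along {p q} (M : 'rV[R]_n -> 'M[R]_(p, q)) alpha x : U x ->
  smooth_mx W M ->
  mpd alpha (fun y => M (u y)) x = \sum_c e alpha c x *: mpd c M (u x).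
Proof.
move=> Ux CM; apply/matrixP => r s; rewrite mpd_entry summxE.
rewrite (pd_along _ Ux (CM r s)); apply: eq_bigr => c _.
by rewrite [RHS]mxE mpd_entry.
Qed.

Lemma mpd_ambient_metric alpha x : U x ->
  mpd alpha ambient_metric x
  = conn alpha x *m ambient_metric x + ambient_metric x *m (conn alpha x)^T.
Proof.
move=> Ux; rewrite /ambient_metric mpd_along //; last by case: gW.
(* Writing the metric as its own transpose turns the second term into the transpose of the first,
   the shape of [mpd_metric]. *)
rewrite -[X in _ + X *m _](_ : (g (u x))^T = _); last first.
  by case: gW => _ + _; apply; apply: uUW.
rewrite -trmx_mul /conn mulmx_suml raddf_sum -big_split /=; apply: eq_bigr => c _.
by rewrite (mpd_metric oW gW _ (uUW Ux)) scalerDr -scalemxAl linearZ.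
Qed.

Lemma metric_tr x : U x -> (ambient_metric x)^T = ambient_metric x.
Proof. by move=> Ux; case: gW => _ + _; apply; apply: uUW. Qed.

Lemma pullbackE x : h x = jac x *m ambient_metric x *m (jac x)^T.
Proof. by []. Qed.

(** Leibniz rule for inner products of fields along Y. General [A] and [B] let it differentiate both
    the induced metric and [conn_lower]. *)
Lemma mpd_inner {p q} (A : 'rV[R]_k -> 'M[R]_(p, n)) (B : 'rV[R]_k -> 'M[R]_(q, n))
    alpha x : U x -> smooth_mx U A -> smooth_mx U B ->
  mpd alpha (fun y => A y *m ambient_metric y *m (B y)^T) x
  = (mpd alpha A x + A x *m conn alpha x) *m ambient_metric x *m (B x)^T
    + A x *m ambient_metric x *m (mpd alpha B x + B x *m conn alpha x)^T.
Proof.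
move=> Ux CA CB.
rewrite (mpdM _ oU Ux) //; first last.
- exact: smooth_mx_tr.
- exact: smooth_mxM.
rewrite (mpdM _ oU Ux) // mpd_tr mpd_ambient_metric //.
rewrite [(_ + _)^T]linearD /= trmx_mul !mulmxDl !mulmxDr !mulmxDl !mulmxA.
by rewrite -!addrA; congr (_ + (_ + _)); rewrite addrC.
Qed.

Lemma mpd_pullback alpha x : U x ->
  mpd alpha h x = conn_lower alpha x + (conn_lower alpha x)^T.
Proof.
move=> Ux; rewrite [LHS](mpd_inner _ Ux smooth_jac smooth_jac) -/(sff_full _ _).
by rewrite /conn_lower !trmx_mul trmxK (metric_tr Ux) mulmxA.
Qed.

Lemma pd_tangent_sym alpha beta b x : U x ->
  pd alpha (e beta b) x = pd beta (e alpha b) x.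
Proof.
move=> Ux; pose ub y := u y 0 b.
have eE gamma y : U y -> e gamma b y = pd gamma ub y.
  by move=> Uy; rewrite /tangent jacobianE //; exact: smooth_on_differentiable Cu Uy.
rewrite (pdE _ oU (eE beta) Ux) (pdE _ oU (eE alpha) Ux).
exact: pd_comm oU (smooth_on_coord b oU Cu) Ux.
Qed.

Lemma sff_full_entry alpha beta b x : sff_full alpha x beta b
  = pd alpha (e beta b) x
    + \sum_c \sum_d christoffel g b c d (u x) * e alpha c x * e beta d x.
Proof.
rewrite /sff_full [LHS]mxE mpd_entry; congr (_ + _).
rewrite mxE exchange_big; apply: eq_bigr => d _.
rewrite conn_entry mulr_sumr; apply: eq_bigr => c _.
by rewrite -/(e beta d x); ring.
Qed.

(** Second partials of [u] commute and the ambient connection is torsion-free. *)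
Lemma sff_full_sym alpha beta b x : U x ->
  sff_full alpha x beta b = sff_full beta x alpha b.
Proof.
move=> Ux; rewrite !sff_full_entry (pd_tangent_sym alpha beta b Ux); congr (_ + _).
rewrite exchange_big; apply: eq_bigr => d _; apply: eq_bigr => c _.
by rewrite (christoffel_sym oW gW _ _ _ (uUW Ux)) mulrAC.
Qed.

Let smooth_conn_lower alpha : smooth_mx U (conn_lower alpha).
Proof.
by apply: smooth_mxM => //; [apply: smooth_mxM|apply: smooth_mx_tr].
Qed.

Lemma conn_lower_sym alpha gamma delta x : U x ->
  conn_lower alpha x gamma delta = conn_lower gamma x alpha delta.
Proof.
move=> Ux; rewrite /conn_lower [LHS]mxE [RHS]mxE; apply: eq_bigr => b _.
congr (_ * _); rewrite [LHS]mxE [RHS]mxE; apply: eq_bigr => a _.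
by rewrite sff_full_sym.
Qed.

Lemma pd_pullback alpha beta gamma x : U x ->
  pd alpha (fun y => h y beta gamma) x
  = conn_lower alpha x beta gamma + conn_lower alpha x gamma beta.
Proof.
move=> Ux; have := mpd_pullback alpha Ux => /matrixP/(_ beta gamma).
by rewrite mpd_entry => ->; rewrite [LHS]mxE [X in _ + X]mxE.
Qed.

(** Koszul's argument: [conn_lower] is symmetric in its first two indices, and its symmetrization in
    the last two gives the derivatives of [h]; these properties determine it. Geometrically, the
    tangential part of the ambient connection is the Levi-Civita connection of [h]. *)
Lemma christoffel_pullback alpha x : U x ->
  christoffel_mx h alpha x *m h x = conn_lower alpha x.
Proof.
move=> Ux; apply/matrixP => gamma delta.
rewrite (christoffel_lower hU _ _ _ Ux) !pd_pullback //.
rewrite (conn_lower_sym gamma alpha) // (conn_lower_sym delta alpha gamma) //.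
by rewrite (conn_lower_sym gamma delta alpha) //; lra.
Qed.

Lemma mpd_conn_lower alpha beta x : U x ->
  mpd alpha (conn_lower beta) x
  = (mpd alpha (sff_full beta) x + sff_full beta x *m conn alpha x)
      *m ambient_metric x *m (jac x)^T
    + sff_full beta x *m ambient_metric x *m (sff_full alpha x)^T.
Proof.
by move=> Ux; rewrite [LHS](mpd_inner _ Ux (smooth_sff_full beta) smooth_jac).
Qed.

(** The second partials of [jac] and the products of a first partial with a connection matrix are
    symmetric in [alpha] and [beta]. What survives is the curvature of [conn], applied to the rows
    of [jac]. *)
Lemma sff_full_comm alpha beta x : U x ->
  mpd alpha (sff_full beta) x + sff_full beta x *m conn alpha x
  - (mpd beta (sff_full alpha) x + sff_full alpha x *m conn beta x)
  = jac x *m (mpd alpha (conn beta) x - mpd beta (conn alpha) x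
              + conn beta x *m conn alpha x - conn alpha x *m conn beta x).
Proof.
have D eta zeta : U x -> mpd eta (sff_full zeta) x + sff_full zeta x *m conn eta x
    = mpd eta (mpd zeta jac) x + jac x *m mpd eta (conn zeta) x
      + mpd eta jac x *m conn zeta x + mpd zeta jac x *m conn eta x
      + jac x *m (conn zeta x *m conn eta x).
  move=> Ux; rewrite (mpdD _ Ux); first last.
  - exact: smooth_mxM.
  - exact: smooth_mpd.
  rewrite (mpdM _ oU Ux) // /sff_full mulmxDl mulmxA !addrA.
  have alg (p q r s t : 'M[R]_(k, n)) : p + (q + r) + s + t = p + r + q + s + t.
    by apply/matrixP => i j; rewrite !mxE; ring.
  by rewrite -alg !addrA.
move=> Ux; rewrite (D alpha beta Ux) (D beta alpha Ux).
rewrite (mpd_comm alpha beta oU Ux smooth_jac) mulmxBr mulmxDr mulmxBr.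
have alg (p q r s t v w : 'M[R]_(k, n)) :
    p + q + r + s + t - (p + v + s + r + w) = q - v + t - w.
  by apply/matrixP => i j; rewrite !mxE; ring.
exact: alg.
Qed.

Lemma mpd_conn alpha beta x : U x ->
  mpd alpha (conn beta) x
  = \sum_b pd alpha (e beta b) x *: christoffel_mx g b (u x)
    + \sum_b \sum_a (e alpha a x * e beta b x) *: mpd a (christoffel_mx g b) (u x).
Proof.
move=> Ux; apply/matrixP => c d; rewrite mpd_entry [RHS]mxE !summxE.
have Cc b : smooth_on U (fun y => christoffel g d b c (u y)).
  exact: smooth_along (smooth_christoffel oW gW _ _ _).
transitivity (pd alpha (fun y => \sum_b e beta b y * christoffel g d b c (u y)) x).
  by congr (pd alpha _ x); apply/funext => y; rewrite conn_entry.
rewrite (pd_sum _ _ oU Ux) => [|b]; last first.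
  by apply: smooth_onM => //; exact: smooth_tangent.
rewrite -big_split; apply: eq_bigr => b _ /=.
rewrite (pdM _ Ux); first last.
- exact: smooth_on_differentiable (Cc b) Ux.
- exact: smooth_on_differentiable (smooth_tangent oU Cu beta b) Ux.
congr (_ + _); first by rewrite [RHS]mxE christoffel_mx_entry.
rewrite (pd_along _ Ux (smooth_christoffel oW gW _ _ _)) mulr_sumr summxE.
apply: eq_bigr => a _; rewrite [RHS]mxE mpd_entry mulrCA mulrA.
congr (_ * _); congr (pd a _ (u x)).
by apply/funext => y; rewrite christoffel_mx_entry.
Qed.

Definition curv_along alpha beta x : 'M[R]_n :=
  \sum_b \sum_a (e alpha a x * e beta b x) *: riem_mx g a b (u x).

Lemma conn_mul alpha beta x : conn beta x *m conn alpha x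
  = \sum_b \sum_a (e alpha a x * e beta b x)
      *: (christoffel_mx g b (u x) *m christoffel_mx g a (u x)).
Proof.
rewrite {1}/conn mulmx_suml; apply: eq_bigr => b _.
rewrite /conn mulmx_sumr; apply: eq_bigr => a _.
by rewrite -scalemxAl -scalemxAr scalerA mulrC.
Qed.

(** The terms of [mpd_conn] with second derivatives of [u] are symmetric in [alpha] and [beta] and
    drop out; the others assemble into [riem_mxE] at [u x]. *)
Lemma curv_alongE alpha beta x : U x ->
  mpd alpha (conn beta) x - mpd beta (conn alpha) x
  + conn beta x *m conn alpha x - conn alpha x *m conn beta x
  = - curv_along alpha beta x.
Proof.
move=> Ux.
have swap (F : 'I_n -> 'I_n -> 'M[R]_n) :
    \sum_b \sum_a (e beta a x * e alpha b x) *: F a b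
    = \sum_b \sum_a (e alpha a x * e beta b x) *: F b a.
  rewrite exchange_big; apply: eq_bigr => b _; apply: eq_bigr => a _.
  by rewrite mulrC.
rewrite !mpd_conn // !conn_mul !swap.
rewrite (eq_bigr (fun b => pd beta (e alpha b) x *: christoffel_mx g b (u x))); last first.
  by move=> b _; rewrite pd_tangent_sym.
rewrite [X in X - _ + _ - _]addrC addrKA -!sumrN -!big_split /=; apply: eq_bigr => b _.
rewrite -!sumrN -!big_split /=; apply: eq_bigr => a _.
by rewrite (riem_mxE oW gW _ _ (uUW Ux)) scalerN opprK -!scalerN -!scalerDr.
Qed.

(* The form (v, w) |-> g(Nv, Nw), N the projection to NY. *)
Definition normal_form x : 'M[R]_n := ambient_metric x
  - ambient_metric x *m (jac x)^T *m invmx (h x) *m jac x *m ambient_metric x.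

Lemma mul_normal_form alpha beta x : U x ->
  sff_full beta x *m normal_form x *m (sff_full alpha x)^T
  = sff_full beta x *m ambient_metric x *m (sff_full alpha x)^T
    - conn_lower beta x *m invmx (h x) *m (conn_lower alpha x)^T.
Proof.
move=> Ux; rewrite /normal_form /conn_lower mulmxBr mulmxBl; congr (_ - _).
by rewrite !trmx_mul trmxK (metric_tr Ux) !mulmxA.
Qed.

(** Differentiate [christoffel_pullback]. Compatibility splits the derivative of [h] in two: one
    half produces the product of the two Christoffel matrices, the other the term with
    [invmx (h x)]. *)
Lemma mpd_christoffel_lower alpha beta x : U x ->
  (mpd alpha (christoffel_mx h beta) x
    + christoffel_mx h beta x *m christoffel_mx h alpha x) *m h x
  = mpd alpha (conn_lower beta) x
    - conn_lower beta x *m invmx (h x) *m (conn_lower alpha x)^T.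
Proof.
move=> Ux; have CG := smooth_christoffel_mx oU hU.
have hx : h x \in unitmx by exact: hunit.
rewrite -(mpdE (M := fun y => christoffel_mx h beta y *m h y)
  (N := conn_lower beta) alpha oU Ux); last first.
  by move=> y Uy; rewrite christoffel_pullback.
rewrite (mpdM _ oU Ux) //; last by move=> i j; exact: smooth_metric hU i j.
rewrite (mpd_metric oU hU _ Ux) -(christoffel_pullback beta Ux).
rewrite -(christoffel_pullback alpha Ux) mulmxK //.
by rewrite mulmxDl mulmxDr !mulmxA addrA addrK.
Qed.

(** After antisymmetrization, each product S M S^T from [mpd_conn_lower] meets a product K h^-1 K^T,
    and [mul_normal_form] merges the pair, removing the tangential part of S. *)
Lemma gauss_mx alpha beta x : U x ->
  riem_mx h alpha beta x *m h x
  = jac x *m curv_along alpha beta x *m ambient_metric x *m (jac x)^T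
    - sff_full beta x *m normal_form x *m (sff_full alpha x)^T
    + sff_full alpha x *m normal_form x *m (sff_full beta x)^T.
Proof.
move=> Ux; rewrite !mul_normal_form // (riem_mxE oU hU _ _ Ux).
have regroup (p q r s : 'M[R]_k) : - (p - q + r - s) = - ((p + r) - (q + s)).
  by apply/matrixP => i j; rewrite !mxE; ring.
rewrite regroup mulNmx mulmxBl !mpd_christoffel_lower // !mpd_conn_lower //.
have := sff_full_comm alpha beta Ux; rewrite curv_alongE // mulmxN => comm.
have -> : jac x *m curv_along alpha beta x =
  mpd beta (sff_full alpha) x + sff_full alpha x *m conn beta x
  - (mpd alpha (sff_full beta) x + sff_full beta x *m conn alpha x).
  by rewrite -[LHS]opprK -comm opprB.
rewrite !mulmxBl.
have alg (p q r s t v : 'M[R]_k) : - (p + q - r - (s + t - v))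
    = s - p - (q - r) + (t - v).
  by apply/matrixP => i j; rewrite !mxE; ring.
exact: alg.
Qed.

End Gauss.

(** * Tangential components of the ambient Weyl tensor *)

Section Tangential.
Local Opaque pd christoffel mpd christoffel_mx riem_mx riem_up riem.
Context {R : realType} {k n : nat}.
Variable u : 'rV[R]_k -> 'rV[R]_n.
Local Notation e := (tangent u).
Implicit Types (S T : 'I_n -> 'I_n -> 'rV[R]_n -> R).
Implicit Types (Q : 'I_n -> 'I_n -> 'I_n -> 'I_n -> 'rV[R]_n -> R).
Implicit Types (alpha beta gamma delta : 'I_k) (x : 'rV[R]_k).

Lemma tan4_mul13 S T alpha beta gamma delta x :
  tan4 u (fun a b c d y => S a c y * T b d y) alpha beta gamma delta x
  = tan2 u S alpha gamma x * tan2 u T beta delta x.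
Proof.
rewrite /tan4 /tan2 mulr_suml; apply: eq_bigr => a _.
rewrite mulr_suml exchange_big; apply: eq_bigr => c _.
rewrite mulr_sumr; apply: eq_bigr => b _.
by rewrite mulr_sumr; apply: eq_bigr => d _; ring.
Qed.

Lemma tan4_mul14 S T alpha beta gamma delta x :
  tan4 u (fun a b c d y => S a d y * T b c y) alpha beta gamma delta x
  = tan2 u S alpha delta x * tan2 u T beta gamma x.
Proof.
rewrite -tan4_mul13 /tan4; apply: eq_bigr => a _; apply: eq_bigr => b _.
by rewrite exchange_big; apply: eq_bigr => d _; apply: eq_bigr => c _; ring.
Qed.

Lemma tan4D Q Q' alpha beta gamma delta x :
  tan4 u (fun a b c d y => Q a b c d y + Q' a b c d y) alpha beta gamma delta x
  = tan4 u Q alpha beta gamma delta x + tan4 u Q' alpha beta gamma delta x.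
Proof.
rewrite /tan4 -big_split; apply: eq_bigr => a _ /=.
rewrite -big_split; apply: eq_bigr => b _ /=.
rewrite -big_split; apply: eq_bigr => c _ /=.
by rewrite -big_split; apply: eq_bigr => d _ /=; rewrite !mulrDl.
Qed.

Lemma tan4N Q alpha beta gamma delta x :
  tan4 u (fun a b c d y => - Q a b c d y) alpha beta gamma delta x
  = - tan4 u Q alpha beta gamma delta x.
Proof.
rewrite /tan4 -sumrN; apply: eq_bigr => a _.
rewrite -sumrN; apply: eq_bigr => b _.
rewrite -sumrN; apply: eq_bigr => c _.
by rewrite -sumrN; apply: eq_bigr => d _; rewrite !mulNr.
Qed.

Lemma tan4_weyl (g : 'rV[R]_n -> 'M[R]_n) alpha beta gamma delta x :
  let h := pullback_metric g u in let P := tan2 u (schouten g) in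
  tan4 u (weyl g) alpha beta gamma delta x
  = tan4 u (riem g) alpha beta gamma delta x
    - P alpha gamma x * h x beta delta - P beta delta x * h x alpha gamma
    + P alpha delta x * h x beta gamma + P beta gamma x * h x alpha delta.
Proof.
move=> h P.
have tan2g eta zeta : tan2 u (fun a b y => g y a b) eta zeta x = h x eta zeta.
  rewrite /h pullback_metricE /tan2 exchange_big; apply: eq_bigr => b _.
  by rewrite mulr_suml; apply: eq_bigr => a _; ring.
pose metric a b y := g y a b : R.
have -> : weyl g = (fun a b c d y => riem g a b c d y
    + - (schouten g a c y * metric b d y) + - (metric a c y * schouten g b d y)
    + schouten g a d y * metric b c y + metric a d y * schouten g b c y).
  by do 5!apply/funext => ?; rewrite /weyl /metric; ring.
rewrite !tan4D !tan4N !tan4_mul13 !tan4_mul14 !tan2g.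
by rewrite /P; ring.
Qed.

End Tangential.

(** * Contractions with the inverse metric *)

Section Contraction.
Local Opaque pd christoffel mpd christoffel_mx riem_mx riem_up riem.
Context {R : realType} {m : nat}.
Variables (W : set 'rV[R]_m) (g : 'rV[R]_m -> 'M[R]_m).
Hypotheses (oW : open W) (gW : metric_on W g).
Variable x : 'rV[R]_m.
Hypothesis Wx : W x.
Implicit Types (a b c d : 'I_m).
Local Notation gi a b := (ginv g a b x).

Lemma ginv_contractl (t : 'I_m -> R) a :
  \sum_c \sum_d gi c d * g x c a * t d = t a.
Proof.
rewrite exchange_big (bigD1 a) //= [X in _ + X]big1 => [|d da].
  rewrite addr0 -mulr_suml -[RHS]mul1r; congr (_ * _).
  rewrite -[RHS](_ : (a == a)%:R = 1); last by rewrite eqxx.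
  rewrite -(ginvK gW a a Wx); apply: eq_bigr => c _.
  by rewrite mulrC (metric_symE gW c a Wx).
rewrite -mulr_suml -[RHS](mul0r (t d)); congr (_ * _).
rewrite -[RHS](_ : (a == d)%:R = 0); last by rewrite eq_sym (negbTE da).
rewrite -(ginvK gW a d Wx); apply: eq_bigr => c _.
by rewrite mulrC (metric_symE gW c a Wx).
Qed.

Lemma tr2_metric : tr2 g (fun a b y => g y a b) x = m%:R.
Proof.
rewrite /tr2; transitivity (\sum_(a < m) (1 : R)); last first.
  by rewrite sumr_const card_ord.
apply: eq_bigr => a _; rewrite -[RHS](_ : (a == a)%:R = 1); last by rewrite eqxx.
rewrite -(ginvK gW a a Wx); apply: eq_bigr => b _.
by rewrite mulrC (ginv_sym gW a b Wx).
Qed.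

Lemma ricci_riem a b : ricci g a b x = \sum_c \sum_d gi c d * riem g a c b d x.
Proof.
rewrite /ricci; apply: eq_bigr => c _.
transitivity (\sum_d gi c d * \sum_e riem_up g a c b e x * g x e d); last first.
  by apply: eq_bigr => d _; congr (_ * _).
rewrite (eq_bigr (fun d => \sum_e riem_up g a c b e x * (g x e d * gi d c))).
  rewrite exchange_big (bigD1 c) //= [X in _ + X]big1 => [|e ec].
    by rewrite -mulr_sumr (ginvK gW c c Wx) eqxx mulr1 addr0.
  by rewrite -mulr_sumr (ginvK gW e c Wx) (negbTE ec) mulr0.
move=> d _; rewrite mulr_sumr; apply: eq_bigr => e _.
by rewrite (ginv_sym gW c d Wx); ring.
Qed.

End Contraction.

Section BilinearForm.
Context {R : realType} {n : nat}.
Variable B : 'M[R]_n.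
Implicit Types v w : 'I_n -> R.

(** Used with [B] the inverse ambient metric: the inner product of covectors along Y, such as [sff]
    and [mean_curv], whose normal index is lowered. *)
Definition bform v w : R := \sum_a \sum_b B a b * v a * w b.

Lemma bform_sym v w : B^T = B -> bform v w = bform w v.
Proof.
move=> BT; rewrite /bform exchange_big; apply: eq_bigr => b _.
by apply: eq_bigr => a _; rewrite -{1}BT mxE mulrAC.
Qed.

Lemma bform_suml (I : Type) (r : seq I) (c : I -> R) (v : I -> 'I_n -> R) w :
  bform (fun a => \sum_(i <- r) c i * v i a) w
  = \sum_(i <- r) c i * bform (v i) w.
Proof.
rewrite /bform [RHS](eq_bigr (fun i => \sum_a \sum_b B a b * (c i * v i a) * w b)).
  rewrite [RHS]exchange_big; apply: eq_bigr => a _; rewrite [RHS]exchange_big.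
  by apply: eq_bigr => b _; rewrite mulr_sumr mulr_suml.
move=> i _; rewrite mulr_sumr; apply: eq_bigr => a _.
by rewrite mulr_sumr; apply: eq_bigr => b _; ring.
Qed.

Lemma bformZl (c : R) v w : bform (fun a => c * v a) w = c * bform v w.
Proof.
rewrite /bform mulr_sumr; apply: eq_bigr => a _.
by rewrite mulr_sumr; apply: eq_bigr => b _; ring.
Qed.

(** The shape is that of [sff0]: [sff] minus [mean_curv] times an entry of [h]. *)
Lemma bformBZl v v' (t : R) w :
  bform (fun a => v a - v' a * t) w = bform v w - t * bform v' w.
Proof.
rewrite /bform mulr_sumr -sumrB; apply: eq_bigr => a _.
by rewrite mulr_sumr -sumrB; apply: eq_bigr => b _; ring.
Qed.

Lemma bform_mx {p q} (M : 'M[R]_(p, n)) (N : 'M[R]_(q, n)) i j :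
  bform (fun a => M i a) (fun b => N j b) = (M *m B *m N^T) i j.
Proof.
rewrite mxE /bform exchange_big; apply: eq_bigr => b _.
rewrite mxE [N^T _ _]mxE mulr_suml; apply: eq_bigr => a _.
by rewrite [M i a * _]mulrC.
Qed.

End BilinearForm.

(** * The Gauss equation in components *)

Section GaussEquation.
Local Opaque pd christoffel mpd christoffel_mx riem_mx riem_up riem sff_full.
Context {R : realType} {k n : nat}.
Variables (U : set 'rV[R]_k) (W : set 'rV[R]_n).
Variables (g : 'rV[R]_n -> 'M[R]_n) (u : 'rV[R]_k -> 'rV[R]_n).
Hypotheses (oU : open U) (oW : open W) (gW : metric_on W g).
Hypotheses (Cu : smooth_on U u) (uUW : forall x, U x -> W (u x)).
Hypothesis hunit : forall x, U x -> pullback_metric g u x \in unitmx.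
Variable x : 'rV[R]_k.
Hypothesis Ux : U x.
Local Notation h := (pullback_metric g u).
Local Notation e := (tangent u).
Implicit Types (alpha beta gamma delta : 'I_k) (a b c d : 'I_n).
Local Notation hi alpha beta := (ginv h alpha beta x).
Local Notation ip := (bform (invmx (g (u x)))).
Local Notation L alpha beta := (fun a => sff g u alpha beta a x).
Local Notation L0 alpha beta := (fun a => sff0 g u alpha beta a x).
Local Notation Hl := (fun a => mean_curv g u a x).

Let hU : metric_on U h := pullback_metric_on oU gW Cu uUW hunit.

Let G_tr : (g (u x))^T = g (u x).
Proof. by case: gW => _ + _; apply; apply: uUW. Qed.

Let G_unit : g (u x) \in unitmx.
Proof. by case: gW => _ _; apply; apply: uUW. Qed.

Let h_unit : h x \in unitmx.
Proof. exact: hunit. Qed.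

Lemma normal_form_tr : (normal_form g u x)^T = normal_form g u x.
Proof.
rewrite /normal_form linearB /= !trmx_mul trmxK trmx_inv (metric_tr gW uUW Ux).
have [_ symh _] := hU; by rewrite (symh x Ux) !mulmxA.
Qed.

Lemma mul_metric_normal_proj : g (u x) *m normal_proj g u x = normal_form g u x.
Proof.
by rewrite /normal_proj /normal_form /ambient_metric /jac mulmxBr mulmx1 !mulmxA.
Qed.

Lemma normal_form_jac : normal_form g u x *m (jac u x)^T = 0.
Proof.
rewrite /normal_form mulmxBl -!mulmxA.
rewrite [jac u x *m (ambient_metric g u x *m _)]mulmxA -pullbackE.
by rewrite mulVmx // mulmx1 subrr.
Qed.

(** Idempotence of the projection [normal_proj], with indices lowered. *)
Lemma normal_form_idem :
  normal_form g u x *m invmx (g (u x)) *m normal_form g u x = normal_form g u x.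
Proof.
rewrite -mulmxA -{2}mul_metric_normal_proj mulKmx // /normal_proj mulmxBr mulmx1 -!mulmxA.
rewrite [normal_form _ _ _ *m (_ *m _)]mulmxA normal_form_jac.
by rewrite mul0mx subr0.
Qed.

Lemma sffE alpha beta a :
  sff g u alpha beta a x = (sff_full g u alpha x *m normal_form g u x) beta a.
Proof.
transitivity ((g (u x) *m (normal_proj g u x *m (sff_full g u alpha x)^T)) a beta).
  rewrite mxE /sff; apply: eq_bigr => b _; congr (_ * _); rewrite mxE /sff_up.
  by apply: eq_bigr => c _; rewrite [X in _ = _ * X]mxE sff_full_entry.
by rewrite mulmxA mul_metric_normal_proj -[in LHS]normal_form_tr -trmx_mul mxE.
Qed.

Lemma sff_sym alpha beta a : sff g u alpha beta a x = sff g u beta alpha a x.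
Proof.
rewrite !sffE [LHS]mxE [RHS]mxE; apply: eq_bigr => b _.
by rewrite (sff_full_sym oU oW gW Cu uUW _ _ _ Ux).
Qed.

Lemma bform_sff alpha beta gamma delta :
  ip (L alpha beta) (L gamma delta)
  = (sff_full g u alpha x *m normal_form g u x *m (sff_full g u gamma x)^T)
      beta delta.
Proof.
rewrite (_ : ip (L alpha beta) (L gamma delta)
  = ip (fun a => (sff_full g u alpha x *m normal_form g u x) beta a)
       (fun b => (sff_full g u gamma x *m normal_form g u x) delta b)); last first.
  by rewrite /bform; apply: eq_bigr => a _; apply: eq_bigr => b _; rewrite !sffE.
rewrite bform_mx trmx_mul normal_form_tr -!mulmxA.
by rewrite [invmx _ *m _]mulmxA [normal_form _ _ _ *m (_ *m _)]mulmxA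
  [normal_form _ _ _ *m (_ *m _)]mulmxA normal_form_idem.
Qed.

Lemma riem_lower (m : nat) (g' : 'rV[R]_m -> 'M[R]_m) (i j r s : 'I_m) y :
  riem g' i j r s y = (riem_mx g' i j y *m g' y) r s.
Proof.
by rewrite mxE; apply: eq_bigr => t _; rewrite riem_mx_entry.
Qed.

Lemma curv_along_tan4 alpha beta gamma delta :
  (jac u x *m curv_along g u alpha beta x *m ambient_metric g u x *m (jac u x)^T)
    gamma delta
  = tan4 u (riem g) alpha beta gamma delta x.
Proof.
pose F a b := riem_mx g a b (u x) *m g (u x).
have E c d : (curv_along g u alpha beta x *m ambient_metric g u x) c d
    = \sum_a \sum_b e alpha a x * e beta b x * riem g a b c d (u x).
  rewrite /curv_along mulmx_suml summxE exchange_big; apply: eq_bigr => b _.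
  rewrite mulmx_suml summxE; apply: eq_bigr => a _.
  by rewrite -scalemxAl riem_lower [LHS]mxE.
rewrite -(mulmxA (jac u x)) mxE.
rewrite (eq_bigr (fun d => \sum_c \sum_a \sum_b riem g a b c d (u x) * e alpha a x
    * e beta b x * e gamma c x * e delta d x)); last first.
  move=> d _; rewrite mxE mulr_suml; apply: eq_bigr => c _; rewrite E.
  rewrite mulr_sumr mulr_suml; apply: eq_bigr => a _.
  rewrite mulr_sumr mulr_suml; apply: eq_bigr => b _.
  rewrite [X in _ * X]mxE -/(e gamma c x) -/(e delta d x).
  by ring.
rewrite exchange_big /tan4.
under eq_bigr => c _ do rewrite exchange_big.
rewrite exchange_big; apply: eq_bigr => a _.
under eq_bigr => c _ do rewrite exchange_big.
by rewrite exchange_big.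
Qed.

Lemma gauss_equation alpha beta gamma delta :
  riem h alpha beta gamma delta x
  = tan4 u (riem g) alpha beta gamma delta x
    - ip (L beta gamma) (L alpha delta) + ip (L alpha gamma) (L beta delta).
Proof.
rewrite riem_lower (gauss_mx oU oW gW Cu uUW hunit _ _ Ux) !bform_sff.
by rewrite -curv_along_tan4 [LHS]mxE [X in X + _ = _]mxE [X in _ + X + _ = _]mxE.
Qed.

End GaussEquation.

(** * The Gauss-Fialkow equation *)

Section Fialkow.
Local Opaque pd christoffel mpd christoffel_mx riem_mx riem_up riem weyl schouten.
Context {R : realType} {k n : nat}.
Variables (U : set 'rV[R]_k) (W : set 'rV[R]_n).
Variables (g : 'rV[R]_n -> 'M[R]_n) (u : 'rV[R]_k -> 'rV[R]_n).
Hypotheses (oU : open U) (oW : open W) (gW : metric_on W g).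
Hypotheses (Cu : smooth_on U u) (uUW : forall x, U x -> W (u x)).
Hypothesis hunit : forall x, U x -> pullback_metric g u x \in unitmx.
Hypothesis k2 : (2 < k)%N.
Variable x : 'rV[R]_k.
Hypothesis Ux : U x.
Local Notation h := (pullback_metric g u).
Implicit Types (alpha beta gamma delta : 'I_k) (a b c d : 'I_n).
Implicit Types X : 'I_k -> 'I_k -> R.
Local Notation hi alpha beta := (ginv h alpha beta x).
Local Notation ip := (bform (invmx (g (u x)))).
Local Notation L alpha beta := (fun a => sff g u alpha beta a x).
Local Notation L0 alpha beta := (fun a => sff0 g u alpha beta a x).
Local Notation Hl := (fun a => mean_curv g u a x).
Local Notation P := (tan2 u (schouten g)).

Let hU : metric_on U h := pullback_metric_on oU gW Cu uUW hunit.

Let k0 : (k%:R : R) != 0.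
Proof. by rewrite pnatr_eq0 -lt0n (leq_trans _ k2). Qed.

(** Acts on arrays of numbers at the fixed point [x], so that linearity applies to expressions with
    further free indices. *)
Definition ctr X : R := \sum_gamma \sum_delta hi gamma delta * X gamma delta.

Lemma eq_ctr X X' : (forall gamma delta, X gamma delta = X' gamma delta) ->
  ctr X = ctr X'.
Proof.
by move=> E; apply: eq_bigr => gamma _; apply: eq_bigr => delta _; rewrite E.
Qed.

Lemma ctrD X X' :
  ctr (fun gamma delta => X gamma delta + X' gamma delta) = ctr X + ctr X'.
Proof.
rewrite /ctr -big_split; apply: eq_bigr => gamma _ /=.
by rewrite -big_split; apply: eq_bigr => delta _ /=; rewrite mulrDr.
Qed.

Lemma ctrN X : ctr (fun gamma delta => - X gamma delta) = - ctr X.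
Proof.
rewrite /ctr -sumrN; apply: eq_bigr => gamma _.
by rewrite -sumrN; apply: eq_bigr => delta _; rewrite mulrN.
Qed.

Lemma ctrZ (t : R) X : ctr (fun gamma delta => t * X gamma delta) = t * ctr X.
Proof.
rewrite /ctr mulr_sumr; apply: eq_bigr => gamma _.
by rewrite mulr_sumr; apply: eq_bigr => delta _; rewrite mulrCA.
Qed.

Lemma ctr_tr X : ctr (fun gamma delta => X delta gamma) = ctr X.
Proof.
rewrite /ctr exchange_big; apply: eq_bigr => gamma _; apply: eq_bigr => delta _.
by rewrite (ginv_sym hU delta gamma Ux).
Qed.

Lemma ctr_metric : ctr (fun gamma delta => h x gamma delta) = k%:R.
Proof. exact: tr2_metric hU _ Ux. Qed.

Lemma ctr_metricl (t : 'I_k -> R) alpha :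
  ctr (fun gamma delta => h x gamma alpha * t delta) = t alpha.
Proof.
rewrite -[RHS](ginv_contractl hU Ux t alpha); apply: eq_bigr => gamma _.
by apply: eq_bigr => delta _; rewrite mulrA.
Qed.

Lemma ctr_metricr (t : 'I_k -> R) alpha :
  ctr (fun gamma delta => h x delta alpha * t gamma) = t alpha.
Proof. by rewrite (ctr_tr (fun gamma delta => h x gamma alpha * t delta)) ctr_metricl. Qed.

Lemma metric_pullback_sym alpha beta : h x alpha beta = h x beta alpha.
Proof. exact: (metric_symE hU alpha beta Ux). Qed.

Let ip_sym v w : ip v w = ip w v.
Proof.
by apply: bform_sym; rewrite trmx_inv; case: gW => _ -> //; apply: uUW.
Qed.

Lemma ctr_sff v : ctr (fun gamma delta => ip (L gamma delta) v) = k%:R * ip Hl v.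
Proof.
rewrite (_ : ip Hl v = k%:R^-1 * ip (fun a => \sum_gamma \sum_delta
    hi gamma delta * sff g u gamma delta a x) v); last first.
  by rewrite -bformZl.
rewrite mulVKf //.
(* The factor 1 brings the outer sum into the form of [bform_suml]. *)
rewrite (_ : (fun a => _) = (fun a => \sum_gamma 1 * \sum_delta
    hi gamma delta * sff g u gamma delta a x)); last first.
  by apply/funext => a; apply: eq_bigr => gamma _; rewrite mul1r.
rewrite bform_suml; apply: eq_bigr => gamma _; rewrite mul1r.
by rewrite bform_suml.
Qed.

Lemma mean_curv_upE v : \sum_a mean_curv_up g u a x * v a = ip Hl v.
Proof.
rewrite ip_sym; apply: eq_bigr => a _.
by rewrite /mean_curv_up mulr_suml; apply: eq_bigr => b _; rewrite mulrAC.
Qed.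

(** Passing from [sff0] to [sff] subtracts |H|^2 h, which changes the coefficient of |H|^2 h from
    1/2 to -1/2. *)
Lemma calPE alpha beta : calP g u alpha beta x
  = P alpha beta x + ip Hl (L alpha beta) - 2^-1 * ip Hl Hl * h x alpha beta.
Proof.
by rewrite /calP !mean_curv_upE ip_sym /sff0 bformBZl ip_sym; field.
Qed.

(** Each cross term contracts an [h] and gives H.L, equal for both by the symmetry of L; the last
    term contracts [h] with [h]. *)
Lemma sff0_sqE alpha beta : sff0_sq g u alpha beta x
  = ctr (fun gamma delta => ip (L gamma alpha) (L delta beta))
    - 2 * ip Hl (L alpha beta) + ip Hl Hl * h x alpha beta.
Proof.
transitivity (ctr (fun gamma delta => ip (L0 gamma alpha) (L0 delta beta))).
  apply: eq_bigr => gamma _; apply: eq_bigr => delta _.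
  rewrite mulr_sumr; apply: eq_bigr => a _.
  by rewrite mulr_sumr; apply: eq_bigr => b _; rewrite !mulrA.
rewrite (eq_ctr (X' := fun gamma delta => ip (L gamma alpha) (L delta beta)
    + - (h x gamma alpha * ip Hl (L delta beta))
    + - (h x delta beta * ip Hl (L gamma alpha))
    + ip Hl Hl * (h x gamma alpha * h x delta beta))); last first.
  move=> gamma delta; rewrite /sff0 bformBZl.
  rewrite [in X in X - _]ip_sym [in X in _ - X]ip_sym !bformBZl.
  rewrite (ip_sym (L delta beta)) (ip_sym (L delta beta)); ring.
rewrite !ctrD !ctrN ctrZ.
rewrite (ctr_metricl (fun delta => ip Hl (L delta beta))).
rewrite (ctr_metricr (fun gamma => ip Hl (L gamma alpha))).
rewrite (ctr_metricl (fun delta => h x delta beta)).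
rewrite (_ : ip Hl (L beta alpha) = ip Hl (L alpha beta)); first by ring.
by rewrite (_ : L beta alpha = L alpha beta) //; apply/funext => a;
  rewrite (sff_sym oU oW gW Cu uUW hunit Ux).
Qed.

Lemma tr2_ctr (T : 'I_k -> 'I_k -> 'rV[R]_k -> R) :
  tr2 h T x = ctr (fun gamma delta => T gamma delta x).
Proof. by []. Qed.

Lemma ricci_pullback alpha beta : ricci h alpha beta x
  = (k%:R - 2) * calP g u alpha beta x + tr2 h (calP g u) x * h x alpha beta
    + weyl_tr g u alpha beta x - sff0_sq g u alpha beta x.
Proof.
have trP : tr2 h (calP g u) x = ctr (fun gamma delta => P gamma delta x)
    + 2^-1 * k%:R * ip Hl Hl.
  rewrite tr2_ctr (eq_ctr (X' := fun gamma delta => P gamma delta x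
    + ip (L gamma delta) Hl + - (2^-1 * ip Hl Hl * h x gamma delta))).
    by rewrite !ctrD ctrN ctrZ ctr_sff ctr_metric; field.
  by move=> gamma delta; rewrite calPE (ip_sym Hl (L gamma delta)).
have Lsym gamma delta : L gamma delta = L delta gamma.
  by apply/funext => a; rewrite (sff_sym oU oW gW Cu uUW hunit Ux).
have wE : weyl_tr g u alpha beta x
  = ctr (fun gamma delta => tan4 u (weyl g) alpha gamma beta delta x) by [].
rewrite (ricci_riem hU Ux) -/(ctr (fun gamma delta => riem h alpha gamma beta delta x)).
rewrite (eq_ctr (X' := fun gamma delta => tan4 u (weyl g) alpha gamma beta delta x
   + P alpha beta x * h x gamma delta + h x alpha beta * P gamma delta x
   + - (h x gamma beta * P alpha delta x) + - (h x delta alpha * P gamma beta x)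
   + - ip (L delta alpha) (L gamma beta) + ip (L gamma delta) (L alpha beta))); last first.
  move=> gamma delta; rewrite (gauss_equation oU oW gW Cu uUW hunit Ux) tan4_weyl.
  rewrite (metric_pullback_sym alpha delta) (Lsym delta alpha).
  by rewrite (ip_sym (L gamma beta)) (ip_sym (L alpha beta)); ring.
rewrite !ctrD !ctrN !ctrZ ctr_metric ctr_sff.
rewrite (ctr_metricl (fun delta => P alpha delta x)).
rewrite (ctr_metricr (fun gamma => P gamma beta x)).
rewrite (ctr_tr (fun gamma delta => ip (L gamma alpha) (L delta beta))).
by rewrite wE trP calPE sff0_sqE; field.
Qed.

Let exchange_3124 (F : 'I_k -> 'I_k -> 'I_k -> 'I_k -> R) :
  \sum_alpha \sum_beta \sum_gamma \sum_delta F alpha beta gamma delta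
  = \sum_gamma \sum_alpha \sum_delta \sum_beta F alpha beta gamma delta.
Proof.
rewrite [RHS]exchange_big; apply: eq_bigr => alpha _.
rewrite [LHS]exchange_big; apply: eq_bigr => gamma _.
by rewrite exchange_big.
Qed.

Lemma tr2_sff0_sq : tr2 h (sff0_sq g u) x = sff0_normsq g u x.
Proof.
rewrite /tr2 /sff0_normsq.
rewrite (eq_bigr (fun alpha => \sum_beta \sum_gamma \sum_delta hi gamma delta
  * hi alpha beta * ip (L0 gamma alpha) (L0 delta beta))).
  rewrite exchange_3124; apply: eq_bigr => gamma _; apply: eq_bigr => alpha _.
  apply: eq_bigr => delta _; apply: eq_bigr => beta _.
  rewrite mulr_sumr; apply: eq_bigr => a _.
  by rewrite mulr_sumr; apply: eq_bigr => b _; rewrite !mulrA.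
move=> alpha _; apply: eq_bigr => beta _.
rewrite mulr_sumr; apply: eq_bigr => gamma _.
rewrite mulr_sumr; apply: eq_bigr => delta _.
rewrite !mulr_sumr; apply: eq_bigr => a _.
by rewrite !mulr_sumr; apply: eq_bigr => b _; rewrite /ginv; ring.
Qed.

Lemma tr2_weyl_tr : tr2 h (weyl_tr g u) x = weyl_trtr g u x.
Proof.
apply: eq_bigr => alpha _.
rewrite [RHS]exchange_big; apply: eq_bigr => beta _.
rewrite mulr_sumr; apply: eq_bigr => gamma _.
by rewrite mulr_sumr; apply: eq_bigr => delta _; rewrite mulrA.
Qed.

Let k1n : (k%:R : R) - 1 != 0.
Proof. by rewrite subr_eq0 -[1]/(1%:R) eqr_nat neq_ltn (ltnW k2) orbT. Qed.

Let k2n : (k%:R : R) - 2 != 0.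
Proof. by rewrite subr_eq0 eqr_nat neq_ltn k2 orbT. Qed.

(** The factor 2 (k - 1) in [sfG] is chosen for this: the trace is (2 (k - 1) G - k G) / (k - 2). *)
Lemma tr2_sfF : tr2 h (sfF g u) x = sfG g u x.
Proof.
rewrite tr2_ctr (eq_ctr (X' := fun gamma delta => (k%:R - 2)^-1 *
  (sff0_sq g u gamma delta x + - weyl_tr g u gamma delta x
   + - (sfG g u x * h x gamma delta)))); last by [].
rewrite ctrZ !ctrD !ctrN ctrZ ctr_metric -!tr2_ctr tr2_sff0_sq tr2_weyl_tr /sfG.
by field; rewrite k1n k2n.
Qed.

Lemma sff0_sq_weyl_trE alpha beta :
  sff0_sq g u alpha beta x - weyl_tr g u alpha beta x
  = (k%:R - 2) * sfF g u alpha beta x + sfG g u x * h x alpha beta.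
Proof. by rewrite /sfF; field. Qed.

Let sff0_sqE' alpha beta : sff0_sq g u alpha beta x = weyl_tr g u alpha beta x
  + ((k%:R - 2) * sfF g u alpha beta x + sfG g u x * h x alpha beta).
Proof. by rewrite -sff0_sq_weyl_trE addrC subrK. Qed.

(** In the trace of [ricci_pullback], tr [calP] and G both carry the factor (k - 2) + k = 2 (k - 1),
    which is the normalization of [schoutenJ]. *)
Lemma fialkow_trace :
  schoutenJ h x = tr2 h (calP g u) x - sfG g u x.
Proof.
rewrite /schoutenJ /scalar_curvature tr2_ctr.
rewrite (eq_ctr (X' := fun gamma delta => (k%:R - 2) * calP g u gamma delta x
  + tr2 h (calP g u) x * h x gamma delta + - ((k%:R - 2) * sfF g u gamma delta x)
  + - (sfG g u x * h x gamma delta))); last first.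
  move=> gamma delta; rewrite ricci_pullback.
  by rewrite sff0_sqE'; ring.
rewrite !ctrD !ctrN (ctrZ _ (fun gamma delta => calP g u gamma delta x)).
rewrite (ctrZ _ (fun gamma delta => sfF g u gamma delta x)).
rewrite !(ctrZ _ (fun gamma delta => h x gamma delta)) ctr_metric.
rewrite -(tr2_ctr (sfF g u)) -(tr2_ctr (calP g u)) tr2_sfF.
by field.
Qed.

(** By [fialkow_trace] the multiples of [h] in Ric - J h cancel, leaving (k - 2) ([calP] -
    [sfF]). *)
Lemma fialkow alpha beta : schouten_bar g u alpha beta x
  = calP g u alpha beta x - sfF g u alpha beta x.
Proof.
Local Transparent schouten.
rewrite /schouten_bar /schouten fialkow_trace ricci_pullback.
by rewrite sff0_sqE'; field.
Qed.

End Fialkow.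

(** * The extrinsic Q-curvature *)

Section PositiveDefinite.
Context {R : realType} {n : nat}.
Variable M : 'M[R]_n.
Hypothesis posM : forall v : 'rV[R]_n, v != 0 -> 0 < (v *m M *m v^T) 0 0.

(** A row vector v killed by the product satisfies (v A) M (v A)^T = 0, which positivity excludes
    since v A is nonzero. With A the Jacobian of an immersion, this makes the induced metric
    invertible. *)
Lemma congruence_unitmx {k} (A : 'M[R]_(k, n)) : row_free A ->
  A *m M *m A^T \in unitmx.
Proof.
move=> freeA; rewrite -row_free_unit; apply: inj_row_free => v vA0.
apply/eqP; apply: contraT => v0.
have vA : v *m A != 0 by rewrite mulmx_free_eq0.
have := posM vA.
by rewrite trmx_mul !mulmxA -(mulmxA v) -(mulmxA v) vA0 mul0mx mxE ltxx.
Qed.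

Lemma posdef_unitmx : M \in unitmx.
Proof.
have := congruence_unitmx (A := 1%:M).
by rewrite mul1mx trmx1 mulmx1; apply; rewrite row_free_unit unitmx1.
Qed.

End PositiveDefinite.

Section Charts.
Context {R : realType} {k n : nat}.
Context {Y : smooth_manifold R k} {X : smooth_manifold R n}.

Lemma local_dom_open (f : Y -> X) (a : atlas Y) (b : atlas X) :
  continuous f -> open (local_dom f a b).
Proof.
move=> cf; rewrite openE => _ [q [aq bfq] <-].
have imq : (chart a @` chart_dom a) (chart a q) by exists q.
have near_im := open_nbhs_nbhs (conj (@chart_img_open _ _ _ a) imq).
(* A point of the open chart image belongs to the domain once [chart_inv] sends it into the preimage
   of [chart_dom b], and continuity ensures this nearby. *)
have near_b : \forall x \near chart a q, chart_dom b (f (chart_inv a x)).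
  have cinv := chart_inv_continuous imq.
  apply: (cinv [set y | chart_dom b (f y)]); rewrite chartK //.
  apply: (cf q (chart_dom b)).
  by apply: open_nbhs_nbhs; split; [exact: chart_dom_open|].
apply: filterS (filterI near_im near_b) => x [[q' aq' <-]].
by rewrite /= chartK // => bq'; exists q'.
Qed.

End Charts.

Section Divergence.
Local Opaque pd.
Context {R : realType} {m : nat}.
Variables (U : set 'rV[R]_m) (h : 'rV[R]_m -> 'M[R]_m).
Hypothesis oU : open U.
Variable x : 'rV[R]_m.
Hypothesis Ux : U x.

Lemma pdDZ (f f' : 'rV[R]_m -> R) (c : R) i : smooth_on U f -> smooth_on U f' ->
  pd i (fun y => f y + c * f' y) x = pd i f x + c * pd i f' x.
Proof.
move=> Cf Cf'; have Cc := smooth_on_cst (m := m) c oU.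
rewrite (pdD _ Ux Cf (smooth_onM oU Cc Cf')) (pdM _ Ux); first last.
- exact: smooth_on_differentiable Cf' Ux.
- exact: smooth_on_differentiable Cc Ux.
by rewrite [pd i (fun=> c) x]derive_cst mul0r add0r.
Qed.

Lemma divergenceDZ (A B : 'I_m -> 'rV[R]_m -> R) (c : R) :
  (forall i, smooth_on U (A i)) -> (forall i, smooth_on U (B i)) ->
  divergence h (fun i y => A i y + c * B i y) x
  = divergence h A x + c * divergence h B x.
Proof.
move=> CA CB; rewrite /divergence /tr2 mulr_sumr -big_split.
apply: eq_bigr => i _ /=; rewrite mulr_sumr -big_split.
apply: eq_bigr => j _ /=; rewrite /cov1 pdDZ //.
rewrite (eq_bigr (fun d => christoffel h d i j x * A d x
  + c * (christoffel h d i j x * B d x))); last by move=> d _; ring.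
by rewrite big_split -mulr_sumr /=; ring.
Qed.

End Divergence.

Section InnerProduct.
Context {R : realType} {m : nat}.
Variables (W : set 'rV[R]_m) (h : 'rV[R]_m -> 'M[R]_m).
Hypotheses (oW : open W) (hW : metric_on W h).
Variable x : 'rV[R]_m.
Hypothesis Wx : W x.
Implicit Types S T : 'I_m -> 'I_m -> 'rV[R]_m -> R.

Lemma inner2DZl S S' T S'' (s t : R) :
  (forall a b, S a b x = s * S' a b x + t * S'' a b x) ->
  inner2 h S T x = s * inner2 h S' T x + t * inner2 h S'' T x.
Proof.
move=> E; rewrite /inner2 !mulr_sumr -big_split; apply: eq_bigr => a _ /=.
rewrite !mulr_sumr -big_split; apply: eq_bigr => b _ /=.
rewrite !mulr_sumr -big_split; apply: eq_bigr => c _ /=.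
rewrite !mulr_sumr -big_split; apply: eq_bigr => d _ /=.
by rewrite E; ring.
Qed.

Lemma inner2Br S T T' T'' :
  (forall a b, T a b x = T' a b x - T'' a b x) ->
  inner2 h S T x = inner2 h S T' x - inner2 h S T'' x.
Proof.
move=> E; rewrite /inner2 -sumrB; apply: eq_bigr => a _ /=.
rewrite -sumrB; apply: eq_bigr => b _ /=.
rewrite -sumrB; apply: eq_bigr => c _ /=.
rewrite -sumrB; apply: eq_bigr => d _ /=.
by rewrite E; ring.
Qed.

Lemma tr2B T T' T'' : (forall a b, T a b x = T' a b x - T'' a b x) ->
  tr2 h T x = tr2 h T' x - tr2 h T'' x.
Proof.
move=> E; rewrite /tr2 -sumrB; apply: eq_bigr => a _ /=.
by rewrite -sumrB; apply: eq_bigr => b _ /=; rewrite E mulrBr.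
Qed.

Lemma inner2_metric T : inner2 h (fun a b y => h y a b) T x = tr2 h T x.
Proof.
transitivity (\sum_b \sum_d ginv h b d x
    * \sum_a \sum_c ginv h a c x * h x a b * T c d x).
  rewrite /inner2 exchange_big; apply: eq_bigr => b _.
  under [LHS]eq_bigr => a _ do rewrite exchange_big.
  rewrite exchange_big; apply: eq_bigr => d _; rewrite mulr_sumr.
  apply: eq_bigr => a _; rewrite mulr_sumr; apply: eq_bigr => c _; ring.
apply: eq_bigr => b _; apply: eq_bigr => d _; congr (_ * _).
exact: (ginv_contractl hW Wx (fun c => T c d x) b).
Qed.

End InnerProduct.

Unset Implicit Arguments.
Local Open Scope ring_scope.

Theorem proposition5p19 (R : realType) (n : nat)
    (X : smooth_manifold R n) (metricX : riemannian_metric X)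
    (Y : smooth_manifold R 4) (i : Y -> X) :
  (4 < n)%N -> immersion i ->
  forall (p : Y) (a : atlas Y) (b : atlas X),
  chart_dom a p -> chart_dom b (i p) ->
  let x := chart a p in
  let g := metric_in metricX b in
  let u := local_rep i a b in
  let h := pullback_metric g u in
  let WQ := fun y =>
    - 4^-1 * normsq4 h (weyl h) y + calI g u y
    + 2 * inner2 h (sfF g u) (sfF g u) y - 2 * sfG g u y ^+ 2 in
  let V := fun (alpha : 'I_4) y =>
    pd alpha (J_bar g u) y - 2 * pd alpha (sfG g u) y
    - 2 * calC g u alpha y + 2 * sfD_sff0 g u alpha y in
  extrinsicQ g u x = 2 * pfaffian g u x + WQ x - divergence h V x.
Proof.
move=> _ [[ci Ci] rfi] p a b ap bip x g u h WQ V.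
pose U := local_dom i a b.
pose W := chart b @` chart_dom b.
have oU : open U by exact: local_dom_open.
have oW : open W by exact: chart_img_open.
have Ux : U x by exists p.
have uUW y : U y -> W (u y).
  by move=> [q [aq bq] <-]; exists (i q) => //; rewrite /u /local_rep /= chartK.
have gW : metric_on W g.
  split=> [r s|y Wy|y Wy]; [exact: metric_smooth|exact: Defs.metric_sym|].
  exact/posdef_unitmx/metric_pos.
have Cu : smooth_on U u by exact: Ci.
have hunit y : U y -> h y \in unitmx.
  move=> Uy; apply: congruence_unitmx; last exact: rfi.
  exact/metric_pos/uUW.
have hU : metric_on U h by exact: pullback_metric_on oU gW Cu uUW hunit.
have FG : forall r s, schouten_bar g u r s x = calP g u r s x - sfF g u r s x.
  exact: fialkow oU oW gW Cu uUW hunit _ _ Ux.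
have trF : tr2 h (sfF g u) x = sfG g u x.
  exact: tr2_sfF oU gW Cu uUW hunit _ _ Ux.
have CJ := smooth_J_bar oU gW Cu uUW hunit.
have CG := smooth_sfG oU oW gW Cu uUW hunit.
have CC := smooth_calC oU oW gW Cu uUW hunit.
have CD := smooth_sfD_sff0 oU oW gW Cu uUW hunit.
(* The field under the divergence in [calI], kept as a unit so that the two divergences cancel. *)
pose CDfield alpha y := calC g u alpha y - sfD_sff0 g u alpha y.
have divV : divergence h V x = laplacian h (J_bar g u) x
    - 2 * laplacian h (sfG g u) x - 2 * divergence h CDfield x.
  have -> : V = (fun alpha y => (pd alpha (J_bar g u) y
      + (- 2) * pd alpha (sfG g u) y) + (- 2) * CDfield alpha y).
    by apply/funext => alpha; apply/funext => y; rewrite /V /CDfield; ring.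
  rewrite (divergenceDZ h oU Ux) => [|alpha|alpha]; first last.
  - by apply: smooth_onD => //; apply: smooth_onN.
  - apply: smooth_onD => //; first exact: smooth_on_pd.
    by apply: smooth_onM => //; [exact: smooth_on_cst|exact: smooth_on_pd].
  rewrite (divergenceDZ h oU Ux) => [|alpha|alpha]; first last.
  - exact: smooth_on_pd.
  - exact: smooth_on_pd.
  by rewrite -/(laplacian h (J_bar g u)) -/(laplacian h (sfG g u)) !mulNr.
(* [J_bar] is by definition the trace of [schouten_bar], so tracing [FG] suffices. *)
have trP : J_bar g u x = tr2 h (calP g u) x - sfG g u x.
  by rewrite -trF; apply: tr2B.
have innerFP : inner2 h (sfF g u) (schouten_bar g u) x
    = inner2 h (sfF g u) (calP g u) x - inner2 h (sfF g u) (sfF g u) x.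
  exact: inner2Br.
(* The factor 2 is k - 2. *)
have innerLP : inner2 h (fun r s y => sff0_sq g u r s y - weyl_tr g u r s y)
      (calP g u) x
    = 2 * inner2 h (sfF g u) (calP g u) x + sfG g u x * tr2 h (calP g u) x.
  rewrite -(inner2_metric hU Ux); apply: inner2DZl => r s.
  have k2 : (2 < 4)%N by [].
  by rewrite (sff0_sq_weyl_trE g u k2); ring.
rewrite divV /extrinsicQ /pfaffian /WQ /calI -/CDfield -/h innerFP innerLP trP.
set z := (n%:R - 4)^-1.
(* These terms now match formally. What remains on either side is 4 G tr P - 4 <F, P> + 2 |F|^2 - 2
   G^2, with P standing for [calP]. *)
move: (normsq4 _ _ _) (laplacian h _ x) (laplacian h _ x) (divergence h CDfield x).
by move=> *; field.
Qed.
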